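(* Let $f:\mathbb{N}\to[0,\infty)$ be a function with $f(n)=\mathcal{O}(n^{-r_0})$ for some constant $r_0>1$. Then there is a constant $c_0$, depending only on $f$ and $r_0$, such that the following holds. Let $d\in\mathbb{N}$, $1\le p<d/2$ and $q>p$ be fixed. Let $\xi$ be a probability measure on $\mathbb{R}^d$ with finite $q$-moments whose Lebesgue density exists and is essentially bounded by some $M>0$. Let $(U_i)_{i\in\mathbb{N}}$ be a strictly stationary and $\alpha$-mixing process with marginal distribution $\xi$ and $\alpha(n)\le f(n)$ for all $n$, and let $\xi_n$ be the empirical measure of $U_1,\ldots,U_n$. Then, for any $n,K\in\mathbb{N}$, $$\mathbb{E}d_p^p(\xi_n,\xi)\le 3^{p-1}\left\{2^{p}\left(\left(1-\xi(U_K)\right)^{\frac{q-p}{q}}m_q^{p/q}+\left(1-\xi(U_K)\right)K^p\right)+K^{d/2}\cdot\mathfrak{M}^p\right\},$$ where $U_K$ is the open ball centred at the origin with radius $K$, $m_q$ is the $q$-th moment of $\xi$, and $\mathfrak{M}$ is given by $$\mathfrak{M}^p=c_0\,n^{-\frac{p-2}{2d}}\,2^{3d/2-p}\,d^{\frac p2}\left(\frac{1+M^{\frac{d/2-p}{d}}}{1-2^{p-d/2}}+\frac{1}{1-2^{-p}}+4M^{\frac1d}\right).$$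
   Context: $d_p$ is the Wasserstein distance of order $p$ with respect to the Euclidean norm: $d_p^p(\eta,\xi)=\inf_\gamma\int\|s-s'\|_2^p\,\mathrm{d}\gamma(s,s')$, the infimum being over all couplings $\gamma$ of $\eta$ and $\xi$. $m_q=\int\|x\|_2^q\,\mathrm{d}\xi(x)$. For a process $(U_i)$, $\alpha(n)=\sup_j\sup\{|\mathbb{P}(A\cap B)-\mathbb{P}(A)\mathbb{P}(B)|:A\in\sigma(U_1,\ldots,U_j),B\in\sigma(U_{j+n},U_{j+n+1},\ldots)\}$; the process is $\alpha$-mixing if $\alpha(n)\to0$. *)

(* Defs.v *)
(* MathComp-Analysis.  R^d is d.-tuple (measurableTypeR R), whose product
   sigma-algebra is the Borel one. *)
From HB Require Import structures.
From mathcomp Require Import all_boot all_order all_algebra.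
From mathcomp Require Import all_classical all_reals all_analysis.

Set Implicit Arguments.
Unset Strict Implicit.
Unset Printing Implicit Defensive.

Import Order.TTheory GRing.Theory Num.Theory.
Import numFieldNormedType.Exports.

Local Open Scope classical_set_scope.
Local Open Scope ring_scope.

Notation Rd R d := (d.-tuple (measurableTypeR R)).

Section euclidean.
Context {R : realType} {d : nat}.

Definition enorm (x : Rd R d) : R := Num.sqrt (\sum_(i < d) tnth x i ^+ 2).

Definition edist (x y : Rd R d) : R :=
  Num.sqrt (\sum_(i < d) (tnth x i - tnth y i) ^+ 2).

Definition open_ball0 (r : R) : set (Rd R d) := [set x | enorm x < r].

Definition moment (q : R) (xi : {measure set Rd R d -> \bar R}) : \bar R :=
  (\int[xi]_x (enorm x `^ q)%:E)%E.

End euclidean.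

Section lebesgue_tuple.
Context (R : realType).

Definition tuple_cons {d : nat} (z : measurableTypeR R * Rd R d) : Rd R d.+1 :=
  [the d.+1.-tuple _ of z.1 :: z.2].

Lemma measurable_tuple_cons (d : nat) : measurable_fun setT (@tuple_cons d).
Proof. by apply: (measurable_cons measurable_fst measurable_snd). Qed.

Section step.
Context (d : nat) (mu : {sigma_finite_measure set Rd R d -> \bar R}).

Definition lebesgue_cons : set (Rd R d.+1) -> \bar R :=
  pushforward (@lebesgue_measure R \x mu)%E (@tuple_cons d).

Let lebesgue_cons0 : lebesgue_cons set0 = 0%E.
Proof. by rewrite /lebesgue_cons /pushforward preimage_set0 measure0. Qed.

Let lebesgue_cons_ge0 A : (0 <= lebesgue_cons A)%E.
Proof. exact: (@measure_ge0 _ _ _ (@lebesgue_measure R \x mu)%E). Qed.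

Let lebesgue_cons_sigma_additive : semi_sigma_additive lebesgue_cons.
Proof.
pose m := (@lebesgue_measure R \x mu)%E.
have mc := @measurable_tuple_cons d.
move=> F mF tF mUF; rewrite /lebesgue_cons /pushforward preimage_bigcup.
apply: (@measure_semi_sigma_additive _ _ _ m).
- by move=> n; rewrite -[X in measurable X]setTI; exact: mc.
- apply/trivIsetP => /= i j _ _ ij; rewrite -preimage_setI.
  by move/trivIsetP : tF => /(_ _ _ _ _ ij) ->//; rewrite preimage_set0.
- by rewrite -preimage_bigcup -[X in measurable X]setTI; exact: mc.
Qed.

HB.instance Definition _ := isMeasure.Build _ _ _ lebesgue_cons
  lebesgue_cons0 lebesgue_cons_ge0 lebesgue_cons_sigma_additive.

Lemma lebesgue_cons_sigma_finite : sigma_finite setT lebesgue_cons.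
Proof.
have /sigma_finiteP[F [TF ndF Foo]] := sigma_finiteT (@lebesgue_measure R).
have /sigma_finiteP[G [TG ndG Goo]] := sigma_finiteT mu.
pose g (x : Rd R d.+1) : measurableTypeR R * Rd R d :=
  (thead x, [tuple of behead x]).
have mg : measurable_fun setT g.
  by apply/measurable_fun_pairP; split;
    [exact: measurable_tnth|exact: measurable_behead].
have gK z : g (tuple_cons z) = z.
  by case: z => a b; congr pair; apply/val_inj.
exists (fun n => g @^-1` (F n `*` G n)).
  rewrite -preimage_bigcup -(preimage_setT g); congr (_ @^-1` _).
  rewrite -setXTT TF TG predeqE => -[x y]; split.
    move=> [/= [n _ Fnx] [k _ Gky]]; exists (maxn n k) => //; split.
    - by move: x Fnx; exact/subsetPset/ndF/leq_maxl.
    - by move: y Gky; exact/subsetPset/ndG/leq_maxr.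
  by move=> [n _ []/= ? ?]; split; exists n.
move=> k; have [? ?] := Foo k; have [? ?] := Goo k; split.
  by rewrite -[X in measurable X]setTI; apply: mg => //; exact: measurableX.
rewrite /lebesgue_cons /pushforward -comp_preimage.
rewrite (_ : g \o _ = id); last by apply/funext => z /=; rewrite gK.
by rewrite preimage_id product_measure1E// lte_mul_pinfty// ge0_fin_numE.
Qed.

HB.instance Definition _ :=
  Measure_isSigmaFinite.Build _ _ _ lebesgue_cons lebesgue_cons_sigma_finite.

End step.

(* The d-fold product of the one-dimensional Lebesgue measure. *)
Fixpoint lebesgue_tuple (d : nat) : {sigma_finite_measure set Rd R d -> \bar R} :=
  match d with
  | 0 => [the {sigma_finite_measure set _ -> \bar R} of \d_([tuple] : Rd R 0)]
  | d'.+1 => [the {sigma_finite_measure set _ -> \bar R}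
               of lebesgue_cons (lebesgue_tuple d')]
  end.

End lebesgue_tuple.

Arguments tuple_cons {R d} z.

Definition is_lebesgue_density {R : realType} {d : nat}
    (xi : {measure set Rd R d -> \bar R}) (h : Rd R d -> R) : Prop :=
  [/\ measurable_fun setT h, forall x, 0 <= h x &
      forall A, measurable A ->
        xi A = (\int[lebesgue_tuple R d]_(x in A) (h x)%:E)%E].

Section wasserstein.
Context {R : realType} {d : nat}.
Implicit Types eta xi : {measure set Rd R d -> \bar R}.

Definition is_coupling eta xi (gamma : probability (Rd R d * Rd R d)%type R) :
    Prop :=
  forall A : set (Rd R d), measurable A ->
    gamma (A `*` setT) = eta A /\ gamma (setT `*` A) = xi A.

(* The p-th power of the Wasserstein distance of order p. *)
Definition wasserstein_pow (p : R) eta xi : \bar R :=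
  ereal_inf [set (\int[gamma]_s (edist s.1 s.2 `^ p)%:E)%E
            | gamma in is_coupling eta xi].

End wasserstein.

Section process.
Context {dT dX : measure_display} {T : measurableType dT}
  {X : measurableType dX} {R : realType} {P : probability T R}.
Variable U : nat -> {RV P >-> X}.

Definition strictly_stationary : Prop :=
  forall (k h : nat) (t : 'I_k -> nat) (A : set (k.-tuple X)), measurable A ->
    P [set w | A [tuple U (t i) w | i < k]] =
    P [set w | A [tuple U (t i + h)%N w | i < k]].

Definition sigma_process (I : set nat) : set (set T) :=
  <<s \bigcup_(i in I) preimage_set_system setT (U i) measurable >>.

(* Processes are indexed from 0, so [U i] is U_(i+1) in the usual 1-based
   indexing: {U_1, .., U_j} is {U i | i+1 <= j} and {U_(j+n), ..} is
   {U i | j+n <= i+1}. *)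
Definition alpha_coef (n : nat) : \bar R :=
  ereal_sup [set a : \bar R | exists (j : nat) (A B : set T),
    [/\ (0 < j)%N, sigma_process [set i | (i.+1 <= j)%N] A,
        sigma_process [set i | (j + n <= i.+1)%N] B &
        a = `| P (A `&` B) - P A * P B |%E]].

Definition alpha_mixing : Prop := alpha_coef n @[n --> \oo] --> 0%E.

Definition empirical_measure (n : nat) (w : T) : {measure set X -> \bar R} :=
  [the measure _ _ of
    mscale (n%:R^-1)%:nng (msum (fun i : nat => \d_(U i w)) n)].

End process.

(* Main.v *)
(* The coupling is built at dyadic scales.  Cut the cube [-K, K]^d into 2^(Ld)
   cells (clamping the outside to the outermost cells); match as much mass of
   the two measures as possible inside the cells of level L, then match what is
   left inside the cells of level L - 1, and so on up to the whole space.  The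
   mass that survives the matching at level l + 1 is at most the sum over the
   cells Q of that level of |mu(Q) - nu(Q)|, and it moves within a cell of level
   l, at cost (2 K sqrt d 2^-l)^p.  Pairs with a point outside the ball are paid
   for separately by 2^(p-1) (|x|^p + K^p) on the complement of the ball, which
   Hoelder's inequality integrates to the tail term.

   For mu the empirical measure, E|mu(Q) - xi(Q)| <= sqrt(C / n) with
   C = 1 + 2 sum_k f(k), because the covariances of the indicators are bounded
   by the mixing coefficients and r0 > 1 makes f summable.  Choosing L with
   2^L <= n^(1/(2d)) < 2^(L+1) gives the rate n^(-p/(2d)), which is at
   least as good as n^(-(p-2)/(2d)). *)
Require Import Defs.
From HB Require Import structures.
From mathcomp Require Import all_boot all_order all_algebra.
From mathcomp Require Import all_classical all_reals all_analysis.
From mathcomp Require Import unstable measurable_realfun ring lra.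

Set Implicit Arguments.
Unset Strict Implicit.
Unset Printing Implicit Defensive.

Import Order.TTheory GRing.Theory Num.Theory.
Import numFieldNormedType.Exports.

Local Open Scope classical_set_scope.
Local Open Scope ring_scope.

(** * Multiscale transport plans on a finite set *)

(** Within a class of masses [A j] and [B j], take the product plan [a i * b i'] divided by the
    larger of the two. The marginals then stay below [a] and [b], the lighter side is used up, and
    the unmatched [a]-mass of the class is the positive part of [A j - B j]. *)
Lemma exists_subcoupling_in_classes (R : realFieldType) (I J : finType) (g : I -> J)
    (a b : I -> R) (a_ge0 : forall i, 0 <= a i) (b_ge0 : forall i, 0 <= b i) :
  exists pi : I -> I -> R,
  [/\ forall i i', 0 <= pi i i',
      forall i i', g i != g i' -> pi i i' = 0,
      forall i, \sum_i' pi i i' <= a i,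
      forall i', \sum_i pi i i' <= b i' &
      \sum_i (a i - \sum_i' pi i i') <=
        \sum_j `|\sum_(i | g i == j) a i - \sum_(i | g i == j) b i| ].
Proof.
pose A j := \sum_(i | g i == j) a i; pose B j := \sum_(i | g i == j) b i.
pose m j := Num.max (A j) (B j).
have A0 j : 0 <= A j by apply: sumr_ge0.
have B0 j : 0 <= B j by apply: sumr_ge0.
have m0 j : 0 <= m j by rewrite le_max A0.
have Am j : A j <= m j by rewrite le_max lexx.
have Bm j : B j <= m j by rewrite le_max lexx orbT.
pose pi i i' := if g i == g i' then a i * b i' / m (g i) else 0.
have row i : \sum_i' pi i i' = a i * (B (g i) / m (g i)).
  rewrite /pi -big_mkcond /= mulrA [in RHS]/B mulr_sumr mulr_suml.
  by apply: eq_bigl => i'; rewrite eq_sym.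
have col i' : \sum_i pi i i' = b i' * (A (g i') / m (g i')).
  rewrite /pi -big_mkcond /= mulrA [in RHS]/A mulr_sumr mulr_suml.
  by apply: eq_bigr => i /eqP ->; congr (_ / _); rewrite mulrC.
(* In a class of zero mass the convention that 0 has inverse 0 makes the ratio 0. *)
have le1 x j : 0 <= x -> x <= m j -> x / m j <= 1.
  move=> x0 xm; have := m0 j; rewrite le_eqVlt => /orP[/eqP<-|mj].
    by rewrite invr0 mulr0 ler01.
  by rewrite ler_pdivrMr// mul1r.
exists pi; split.
- move=> i i'; rewrite /pi; case: ifP => // _.
  by rewrite divr_ge0// mulr_ge0.
- by move=> i i' /negbTE; rewrite /pi => ->.
- by move=> i; rewrite row ler_piMr// le1.
- by move=> i; rewrite col ler_piMr// le1.
- rewrite (partition_big g predT)//=; apply: ler_sum => j _.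
  rewrite (eq_bigr (fun i => a i * (1 - B j / m j))); last first.
    by move=> i /eqP <-; rewrite row mulrBr mulr1.
  rewrite -mulr_suml -/(A j) -/(B j).
  rewrite /m; case: (leP (A j) (B j)) => [AB|BA].
    have [B0'|Bn0] := eqVneq (B j) 0.
      have -> : A j = 0 by apply/eqP; rewrite eq_le A0 -B0' AB.
      by rewrite mul0r.
    by rewrite divff// subrr mulr0.
  have An0 : A j != 0 by rewrite gt_eqF// (le_lt_trans (B0 j)).
  rewrite mulrBr mulr1 mulrCA divff// mulr1.
  exact: ler_norm.
Qed.

(** Induction on [L] with [a] and [b] general: match inside the finest classes at unit cost
    [D L.+1], then apply the induction hypothesis to the residual masses. Their total is at most the
    discrepancy at level [L.+1], and charging it [D L] produces the new last summand. *)
Lemma exists_multiscale_plan (R : realFieldType) (I : finType) (J : nat -> finType)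
    (g : forall l, I -> J l) (L : nat) (a b : I -> R) (cost : I -> I -> R)
    (D : nat -> R)
    (g_nested : forall k l i i', (k <= l)%N -> g l i = g l i' -> g k i = g k i')
    (g_root : forall i i', g 0%N i = g 0%N i')
    (D_ge0 : forall l, 0 <= D l)
    (cost_le : forall l i i', (l <= L)%N -> g l i = g l i' -> cost i i' <= D l)
    (a_ge0 : forall i, 0 <= a i) (b_ge0 : forall i, 0 <= b i)
    (sum_ab : \sum_i a i = \sum_i b i) :
  exists pi : I -> I -> R,
  [/\ forall i i', 0 <= pi i i',
      forall i, \sum_i' pi i i' = a i,
      forall i', \sum_i pi i i' = b i' &
      \sum_i \sum_i' pi i i' * cost i i' <= D L * (\sum_i a i) +
        \sum_(l < L) D l *
          \sum_j `|\sum_(i | g l.+1 i == j) a i - \sum_(i | g l.+1 i == j) b i| ].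
Proof.
elim: L a b a_ge0 b_ge0 sum_ab cost_le => [|L IH] a b a0 b0 ab cost_le.
  (* At level 0 there is a single class, so the independent plan costs at most [D 0] per unit of
     mass. *)
  pose s := \sum_i a i.
  have s0 : s = 0 -> forall i, a i = 0 /\ b i = 0.
    move=> s0 i; split.
      by move/psumr_eq0P: s0 => ->.
    by have := s0; rewrite /s ab => /psumr_eq0P ->.
  have row i : \sum_i' a i * b i' / s = a i.
    rewrite -mulr_suml -mulr_sumr -ab -/s.
    have [/s0 /(_ i) [-> _]|sn0] := eqVneq s 0; first by rewrite !mul0r.
    by rewrite mulfK.
  have col i : \sum_i' a i' * b i / s = b i.
    rewrite -mulr_suml -mulr_suml -/s.
    have [/s0 /(_ i) [_ ->]|sn0] := eqVneq s 0; first by rewrite mulr0 mul0r.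
    by rewrite mulrC mulKf.
  have pi0 i i' : 0 <= a i * b i' / s.
    by rewrite divr_ge0 ?mulr_ge0 ?sumr_ge0.
  exists (fun i i' => a i * b i' / s); split => //.
  rewrite big_ord0 addr0 mulr_sumr; apply: ler_sum => i _.
  rewrite -[in leRHS](row i) mulr_sumr; apply: ler_sum => i' _.
  by rewrite mulrC ler_wpM2r// cost_le.
have [pi1 [pi1_ge0 pi1_supp row1 col1 res1]] :=
  exists_subcoupling_in_classes (g L.+1) a0 b0.
pose a' i := a i - \sum_i' pi1 i i'.
pose b' i := b i - \sum_i' pi1 i' i.
have a'0 i : 0 <= a' i by rewrite subr_ge0.
have b'0 i : 0 <= b' i by rewrite subr_ge0.
have ab' : \sum_i a' i = \sum_i b' i.
  by rewrite !sumrB ab [in RHS]exchange_big.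
have cl : forall l i i', (l <= L)%N -> g l i = g l i' -> cost i i' <= D l.
  by move=> l i i' lL; apply: cost_le; exact: leqW.
have [pi2 [pi2_ge0 row2 col2 cost2]] := IH a' b' a'0 b'0 ab' cl.
(* Mass matched inside the finest classes leaves every coarser discrepancy unchanged. *)
have disc l j : (l <= L.+1)%N ->
    \sum_(i | g l i == j) a' i - \sum_(i | g l i == j) b' i =
    \sum_(i | g l i == j) a i - \sum_(i | g l i == j) b i.
  move=> lL; rewrite !sumrB.
  suff -> : \sum_(i | g l i == j) \sum_i' pi1 i i' =
            \sum_(i | g l i == j) \sum_i' pi1 i' i by ring.
  rewrite [RHS]exchange_big [LHS]big_mkcond/=; apply: eq_bigr => i _.
  case: ifPn => gi.
    rewrite [RHS]big_mkcond/=; apply: eq_bigr => i' _; case: ifPn => // gi'.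
    apply: pi1_supp; apply: contra gi' => /eqP e.
    by rewrite -(g_nested _ _ _ _ lL e).
  rewrite big1// => i' gi'; apply: pi1_supp; apply: contra gi => /eqP e.
  by rewrite (g_nested _ _ _ _ lL e).
exists (fun i i' => pi1 i i' + pi2 i i'); split.
- by move=> i i'; rewrite addr_ge0.
- by move=> i; rewrite big_split/= row2 addrC subrK.
- by move=> i; rewrite big_split/= col2 addrC subrK.
rewrite (eq_bigr (fun i => \sum_i' pi1 i i' * cost i i' + \sum_i' pi2 i i' * cost i i'));
  last by move=> i _; rewrite -big_split/=; apply: eq_bigr => i' _; rewrite mulrDl.
have H1 : \sum_i \sum_i' pi1 i i' * cost i i' <= D L.+1 * \sum_i a i.
  rewrite mulr_sumr; apply: ler_sum => i _.
  apply: (le_trans _ (ler_wpM2l (D_ge0 _) (row1 i))).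
  rewrite mulr_sumr; apply: ler_sum => i' _.
  have [e|e] := eqVneq (g L.+1 i) (g L.+1 i'); last by rewrite pi1_supp// mul0r mulr0.
  by rewrite mulrC ler_wpM2r// cost_le.
have H2 := ler_wpM2l (D_ge0 L) res1.
rewrite big_split/= big_ord_recr/= lerD//.
rewrite addrC; apply: (le_trans cost2); rewrite lerD//.
by apply: ler_sum => l _; rewrite ler_wpM2l// ler_sum// => j _; rewrite disc// ltnS ltnW.
Qed.

(** * Summability of the mixing rate *)

(** The integral of a nonnegative function is a supremum over simple functions below it, so
    monotonicity holds without measurability. This allows integrating the Wasserstein cost as a
    function of the sample point. *)
Lemma ge0_le_integral_nonmeasurable d (T : measurableType d) (R : realType)
    (mu : {measure set T -> \bar R}) (f g : T -> \bar R) :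
  (forall x, 0 <= f x)%E -> (forall x, f x <= g x)%E ->
  (\int[mu]_x f x <= \int[mu]_x g x)%E.
Proof.
move=> f0 fg; rewrite !ge0_integralTE//; last by move=> x; exact: le_trans (fg x).
by apply: ereal_sup_le => _ [h hf <-]; exists h => // x; exact: le_trans (fg x).
Qed.

(* With [r = 1 + s], [x^-r] is at most the decrease of [x^(1-r) / (r-1)] over
   [[x-1, x]]. *)
Lemma powRN_le_telescope (R : realType) (s x : R) : 0 < s -> 1 < x ->
  s * x `^ (- (1 + s)) <= (x - 1) `^ (- s) - x `^ (- s).
Proof.
move=> s0 x1; have x0 : 0 < x by lra.
have xn0 : x != 0 by rewrite gt_eqF.
(* After factoring out the power of [x] with exponent [- s], what remains is 1 + s/x <= (1 -
   1/x)^(-s). It follows from exp(y) >= 1 + y and ln(1 - 1/x) <= -1/x. *)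
have e : x - 1 = x * (1 - x^-1) by rewrite mulrBr mulr1 divff.
have y0 : 0 < 1 - x^-1 by rewrite subr_gt0 invf_lt1.
rewrite e powRM ?(ltW x0) ?(ltW y0)// opprD powRD; last by rewrite xn0 implybT.
rewrite powR_inv1 ?(ltW x0)// [_ * (x `^ _)]mulrC.
rewrite -[X in _ <= _ - X]mulr1 -mulrBr mulrCA ler_wpM2l ?powR_ge0//.
rewrite lerBrDr addrC /powR gt_eqF//.
apply: le_trans (expR_ge1Dx _); rewrite lerD2l mulNr -mulrN ler_wpM2l ?(ltW s0)//.
by rewrite lerNr; apply: le_ln1Dx; rewrite ltrN2 invf_lt1.
Qed.

Lemma sum_powRN_le (R : realType) (r : R) (n : nat) : 1 < r ->
  \sum_(1 <= k < n) k%:R `^ (- r) <= 1 + (r - 1)^-1.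
Proof.
move=> r1; set s := r - 1; have s0 : 0 < s by rewrite subr_gt0.
have rE : r = 1 + s by rewrite /s; ring.
(* Keeping the subtracted term of the telescoping sum makes the bound inductive. *)
suff H m : \sum_(1 <= k < m.+2) k%:R `^ (- r) <= 1 + s^-1 - s^-1 * m.+1%:R `^ (- s).
  have s1 : 0 <= s^-1 by rewrite invr_ge0 ltW.
  case: n => [|[|n]]; [by rewrite big_geq ?addr_ge0..|].
  by apply: (le_trans (H n)); rewrite lerBlDr lerDl mulr_ge0 ?powR_ge0.
elim: m => [|m IH]; first by rewrite big_nat1 !powR1; lra.
rewrite big_nat_recr//=.
have := @powRN_le_telescope R s m.+2%:R s0; rewrite ltr1n => /(_ isT).
rewrite -rE.
rewrite (_ : m.+2%:R - 1 = m.+1%:R); last by rewrite -natr1 addrK.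
move=> H; have {}H : m.+2%:R `^ (- r) <= s^-1 * (m.+1%:R `^ (- s) - m.+2%:R `^ (- s)).
  by rewrite ler_pdivlMl.
by move: IH H; rewrite mulrBr; lra.
Qed.

Lemma bigO_powRN_sum_bounded (R : realType) (f : nat -> R) (r : R) : 1 < r ->
  f =O_\oo (fun n : nat => n%:R `^ (- r) : R) ->
  exists2 F : R, 0 <= F & forall n, \sum_(1 <= k < n) f k <= F.
Proof.
move=> r1 /eqO_exP[C C0 [N _ fC]].
pose G := \sum_(0 <= k < N) `|f k|.
exists (G + C * (1 + (r - 1)^-1)).
  rewrite addr_ge0 ?sumr_ge0// mulr_ge0 ?ltW// addr_gt0 ?invr_gt0 ?subr_gt0//.
move=> n; have H k : f k <= (if (k < N)%N then `|f k| else 0) + C * k%:R `^ (- r).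
  have [kN|Nk] := ltnP k N.
    by rewrite (le_trans (ler_norm _))// lerDl mulr_ge0 ?powR_ge0// ltW.
  rewrite add0r (le_trans (ler_norm _))//; have := fC k Nk.
  by rewrite (ger0_norm (powR_ge0 _ _)).
apply: (le_trans (ler_sum _ (fun k _ => H k))).
rewrite big_split/= -mulr_sumr lerD//; last by rewrite ler_wpM2l ?sum_powRN_le// ltW.
set h := fun k => if (k < N)%N then `|f k| else 0.
have h0 k : 0 <= h k by rewrite /h; case: ifP.
have hN : \sum_(N <= k < n + N) h k = 0.
  by rewrite big_nat big1// => k /andP[Nk _]; rewrite /h ltnNge Nk.
(* Since [h] vanishes from [N] on, the sum defining [G] may be extended up to [n + N], a range that
   contains all indices from 1 to [n - 1]. *)
rewrite /G -[leRHS]addr0 -[X in _ + X]hN.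
rewrite [X in _ <= X + _](_ : _ = \sum_(0 <= k < N) h k); last first.
  by apply: eq_big_nat => k /andP[_ kN]; rewrite /h kN.
rewrite -big_cat_nat ?leq_addl//=.
case: n {H hN} => [|n]; first by rewrite big_geq// sumr_ge0.
rewrite [leRHS](@big_cat_nat _ _ _ 1%N)//= addSn//.
rewrite [X in _ <= _ + X](@big_cat_nat _ _ _ n.+1)//= ?ltnS ?leq_addr//.
by rewrite addrCA lerDl addr_ge0// sumr_ge0.
Qed.

(** * Deviation of empirical frequencies *)

Section frequency_deviation.
Context {dT : measure_display} {T : measurableType dT} {R : realType}.
Variables (P : probability T R) (A : nat -> set T) (a : R) (f : nat -> R) (F : R).
Hypothesis mA : forall i, measurable (A i).
Hypothesis PA : forall i, P (A i) = a%:E.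
Hypothesis covA : forall i k, (0 < k)%N ->
  (`|P (A i `&` A (i + k)%N) - P (A i) * P (A (i + k)%N)| <= (f k)%:E)%E.
Hypothesis sum_f : forall n, \sum_(1 <= k < n) f k <= F.

Let X n (w : T) : R := n%:R^-1 * \sum_(i < n) \1_(A i) w - a.

Let c i j : R := fine (P (A i `&` A j)).

Let cE i j : P (A i `&` A j) = (c i j)%:E.
Proof. by rewrite fineK// fin_num_measure//; exact: measurableI. Qed.

Let a_ge0 : 0 <= a.
Proof. by rewrite -lee_fin -(PA 0); exact: measure_ge0. Qed.

Let cov_far i k : (0 < k)%N -> c i (i + k)%N - a ^+ 2 <= f k.
Proof.
move=> k0; have := covA i k0; rewrite !PA cE -EFinM -EFinB abse_EFin lee_fin.
by move=> /ler_normlP[_]; rewrite expr2.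
Qed.

(** The diagonal term is at most 1; the positive lags to the right and to the left of [i] contribute
    at most [F] each. *)
Let cov_row n i : (i < n)%N -> \sum_(j < n) (c i j - a ^+ 2) <= 1 + 2 * F.
Proof.
move=> i_n.
rewrite -(big_mkord predT (fun j => c i j - a ^+ 2)).
rewrite (@big_cat_nat _ _ _ i)//=; last exact: ltnW.
rewrite (@big_ltn _ _ _ i)//=.
have c1 : c i i - a ^+ 2 <= 1.
  have : c i i <= 1 by rewrite -lee_fin -cE; apply: probability_le1; exact: measurableI.
  by have := sqr_ge0 a; lra.
have Hr : \sum_(i.+1 <= j < n) (c i j - a ^+ 2) <= F.
  apply: le_trans (sum_f (n - i)); rewrite -[i.+1]add1n big_addn.
  apply: ler_sum_nat => k /andP[k0 _]; rewrite addnC; exact: cov_far.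
(* Reversing the sum turns the summation index into the lag minus 1, and the symmetry of the
   intersection reduces to [cov_far] started at the smaller index. *)
have Hl : \sum_(0 <= j < i) (c i j - a ^+ 2) <= F.
  apply: le_trans (sum_f i.+1); rewrite big_nat_rev/= big_add1/=.
  apply: ler_sum_nat => k /andP[_ ki]; rewrite add0n.
  have e : (i = (i - k.+1) + k.+1)%N by rewrite subnK.
  rewrite /c setIC -/(c (i - k.+1)%N i) {2}e; exact: cov_far.
lra.
Qed.

Let indA (B : set T) (mB : measurable B) : (\int[P]_w (\1_B w)%:E = P B)%E.
Proof. by rewrite integral_indic// setIT. Qed.

(** The square of the count is the double sum of indicators of [A i] intersected with [A j], so the
    second moment is a double sum of covariances divided by n^2. Each of the [n] rows is bounded by
    [cov_row]. *)
Let integral_sqr n : (0 < n)%N ->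
  (\int[P]_w (X n w ^+ 2)%:E <= ((1 + 2 * F) / n%:R)%:E)%E.
Proof.
move=> n0; have nR : n%:R != 0 :> R by rewrite pnatr_eq0 -lt0n.
have nR0 : 0 < n%:R :> R by rewrite ltr0n.
pose S w : R := \sum_(i < n) \1_(A i) w.
pose S2 w : R := \sum_(i < n) \sum_(j < n) \1_(A i `&` A j) w.
have mS : measurable_fun setT S by apply: measurable_sum => i; exact: measurable_indic.
have mS2 : measurable_fun setT S2.
  apply: measurable_sum => i; apply: measurable_sum => j.
  by apply: measurable_indic; exact: measurableI.
have mX : measurable_fun setT (X n).
  by apply: measurable_funB => //; apply: measurable_funM.
have S0 w : 0 <= S w by apply: sumr_ge0 => i _; rewrite indicE.
have S20 w : 0 <= S2 w by apply: sumr_ge0 => i _; apply: sumr_ge0 => j _; rewrite indicE.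
have SS w : S w ^+ 2 = S2 w.
  rewrite expr2 /S mulr_suml; apply: eq_bigr => i _; rewrite mulr_sumr.
  by apply: eq_bigr => j _; rewrite indicI.
have iS : (\int[P]_w (S w)%:E = (n%:R * a)%:E)%E.
  under eq_integral do rewrite /S -sumEFin.
  rewrite ge0_integral_sum//; last first.
    by move=> i; apply/measurable_EFinP/measurable_indic.
  transitivity (\sum_(i < n) a%:E)%E; first by apply: eq_bigr => i _; rewrite indA ?PA.
  by rewrite sumEFin sumr_const card_ord mulr_natl.
have iS2 : (\int[P]_w (S2 w)%:E = (\sum_(i < n) \sum_(j < n) c i j)%:E)%E.
  under eq_integral do rewrite /S2 -sumEFin.
  rewrite ge0_integral_sum//; last 2 first.
  - move=> i; apply/measurable_EFinP; apply: measurable_sum => j.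
    by apply: measurable_indic; exact: measurableI.
  - by move=> i w _; rewrite lee_fin sumr_ge0// => j _; rewrite indicE.
  rewrite -sumEFin; apply: eq_bigr => i _.
  under eq_integral do rewrite -sumEFin.
  rewrite ge0_integral_sum//; last first.
    by move=> j; apply/measurable_EFinP/measurable_indic; exact: measurableI.
  rewrite -sumEFin; apply: eq_bigr => j _; rewrite indA ?cE//; exact: measurableI.
(* Expanding the square gives the cross term 2aS/n, whose integral is 2a^2. Moving it to the left
   keeps every integrand nonnegative, so that additivity applies directly. *)
have key : (\int[P]_w (X n w ^+ 2)%:E + (2 * a ^+ 2)%:E =
   (n%:R ^- 2 * (\sum_(i < n) \sum_(j < n) c i j) + a ^+ 2)%:E)%E.
  have -> : ((2 * a ^+ 2)%:E = \int[P]_w ((2 * a / n%:R) * S w)%:E)%E.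
    under eq_integral do rewrite EFinM.
    rewrite ge0_integralZl_EFin//; last 3 first.
    - by move=> w _; rewrite lee_fin.
    - exact/measurable_EFinP.
    - by rewrite divr_ge0// mulr_ge0.
    by rewrite iS -EFinM; congr EFin; field.
  rewrite -ge0_integralD//; last 4 first.
  - by move=> w _; rewrite lee_fin sqr_ge0.
  - by apply/measurable_EFinP; exact: measurable_funX.
  - by move=> w _; rewrite lee_fin mulr_ge0// divr_ge0// mulr_ge0.
  - by apply/measurable_EFinP; exact: measurable_funM.
  transitivity (\int[P]_w ((n%:R ^- 2 * S2 w)%:E + (a ^+ 2)%:E))%E.
    apply: eq_integral => w _; rewrite -!EFinD -SS /X -/(S w); congr EFin.
    by field.
  rewrite ge0_integralD//; last 3 first.
  - by move=> w _; rewrite lee_fin mulr_ge0// invr_ge0 exprn_ge0// ltW.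
  - by apply/measurable_EFinP; exact: measurable_funM.
  - by move=> w _; rewrite lee_fin sqr_ge0.
  under eq_integral do rewrite EFinM.
  rewrite ge0_integralZl_EFin//; last 2 first.
  - by move=> w _; rewrite lee_fin.
  - exact/measurable_EFinP.
  by rewrite iS2 integral_cst//= [P setT]probability_setT mule1.
rewrite -(@leeD2rE _ (2 * a ^+ 2)%:E)// key -EFinD lee_fin.
have := ler_sum (index_enum 'I_n) (fun (i : 'I_n) (_ : true) => cov_row (ltn_ord i)).
rewrite sumr_const card_ord -[_ *+ n]mulr_natl.
under eq_bigr do rewrite sumrB sumr_const card_ord.
rewrite sumrB sumr_const card_ord.
set Z := \sum_(i < n) _ => H.
have H2 : Z <= n%:R * (1 + 2 * F) + n%:R * n%:R * a ^+ 2.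
  by move: H; rewrite lerBlDr -mulrnA -[_ *+ (n * n)]mulr_natl natrM.
have : n%:R ^- 2 * Z <= n%:R ^- 2 * (n%:R * (1 + 2 * F) + n%:R * n%:R * a ^+ 2).
  by rewrite ler_wpM2l// invr_ge0 exprn_ge0// ltW.
rewrite [leRHS](_ : _ = (1 + 2 * F) / n%:R + a ^+ 2); last by field.
lra.
Qed.

Lemma frequency_deviation n : (0 < n)%N ->
  (\int[P]_w (`|n%:R^-1 * \sum_(i < n) \1_(A i) w - a|)%:E <=
   (Num.sqrt ((1 + 2 * F) / n%:R))%:E)%E.
Proof.
move=> n0.
(* The empty sum gives [F >= 0], hence [s > 0], which the division by [2 * s] requires. *)
have F0 : 0 <= F by have := sum_f 0; rewrite big_geq.
set s := Num.sqrt _.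
have s0 : 0 < s by rewrite sqrtr_gt0 divr_gt0 ?ltr0n//; lra.
have mX : measurable_fun setT (X n).
  apply: measurable_funB => //; apply: measurable_funM => //.
  by apply: measurable_sum => i; exact: measurable_indic.
(* AM-GM: |X| <= X^2 / (2 s) + s / 2 *)
apply: (@le_trans _ _ (\int[P]_w (((2 * s)^-1)%:E * (X n w ^+ 2)%:E + (s / 2)%:E))%E).
  apply: ge0_le_integral => //.
  - by apply/measurable_EFinP; exact: measurableT_comp.
  - apply: emeasurable_funD => //; apply/measurable_EFinP.
    by apply: measurable_funM => //; exact: measurable_funX.
  - move=> w _; rewrite -EFinM -EFinD lee_fin -/(X n w).
    rewrite -(ler_pM2l (_ : 0 < 2 * s)) ?mulr_gt0// mulrDr mulrA divff ?gt_eqF ?mulr_gt0// mul1r.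
    rewrite -[X n w ^+ 2](real_normK (num_real _)).
    by have := sqr_ge0 (`|X n w| - s); rewrite !expr2; lra.
rewrite ge0_integralD//; last 3 first.
- by move=> w _; rewrite mule_ge0// lee_fin ?sqr_ge0// invr_ge0 mulr_ge0// ltW.
- apply/measurable_EFinP; apply: measurable_funM => //; exact: measurable_funX.
- by move=> w _; rewrite lee_fin divr_ge0// ltW.
rewrite ge0_integralZl_EFin//; last 3 first.
- by move=> w _; rewrite lee_fin sqr_ge0.
- apply/measurable_EFinP; exact: measurable_funX.
- by rewrite invr_ge0 mulr_ge0// ltW.
rewrite integral_cst//= [P setT]probability_setT mule1.
apply: (@le_trans _ _ (((2 * s)^-1)%:E * ((1 + 2 * F) / n%:R)%:E + (s / 2)%:E)%E).
  rewrite leeD2r// lee_wpmul2l ?integral_sqr// lee_fin invr_ge0 mulr_ge0// ltW//.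
rewrite -EFinM -EFinD lee_fin.
have -> : (1 + 2 * F) / n%:R = s ^+ 2.
  by rewrite sqr_sqrtr// divr_ge0//; lra.
by rewrite le_eqVlt; apply/orP; left; apply/eqP; field; rewrite gt_eqF.
Qed.

End frequency_deviation.

(** * From discrete plans to couplings *)

Section finite_partition.
Context {dX : measure_display} {X : measurableType dX} {R : realType} {I : finType}.
Variable c : X -> I.
Hypothesis mc : forall i, measurable (c @^-1` [set i]).

Lemma measurable_preimage_finType (B : pred I) : measurable [set x | B (c x)].
Proof.
rewrite (_ : [set x | B (c x)] = \bigcup_(i in [set i | B i]) (c @^-1` [set i])).
  by apply: fin_bigcup_measurable.
by apply/seteqP; split => [x Bx|x [i Bi /= ->]//]; exists (c x).
Qed.

Lemma measure_finType_partition (mu : {measure set X -> \bar R}) (A : set X) :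
  measurable A -> (mu A = \sum_i mu (A `&` c @^-1` [set i]))%E.
Proof.
move=> mA.
have H (s : seq I) : uniq s ->
    (mu (A `&` [set x | c x \in s]) = \sum_(i <- s) mu (A `&` c @^-1` [set i]))%E.
  elim: s => [_|i s IH /= /andP[i_s us]].
    by rewrite big_nil (_ : _ `&` _ = set0) ?measure0//; apply/seteqP; split => x // [].
  rewrite big_cons -IH// -measureU//.
  - congr (mu _); apply/seteqP; split => x /=; rewrite inE.
      by move=> [Ax /orP[/eqP ->|]]; [left|right].
    by move=> [[Ax ->]|[Ax ->]]; rewrite ?eqxx ?orbT.
  - exact: measurableI.
  - by apply: measurableI => //; exact: measurable_preimage_finType.
  - by apply/seteqP; split => x //= [[_ ->] [_]]; rewrite (negbTE i_s).
rewrite -H ?index_enum_uniq//; congr (mu _); apply/seteqP; split => x //=; last by case.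
by rewrite mem_index_enum.
Qed.

Lemma measure_preimage_finType (mu : {measure set X -> \bar R}) (B : pred I) :
  (mu [set x | B (c x)] = \sum_(i | B i) mu (c @^-1` [set i]))%E.
Proof.
rewrite (measure_finType_partition mu (measurable_preimage_finType B)) [RHS]big_mkcond/=.
apply: eq_bigr => i _; case: ifPn => Bi.
  by congr (mu _); apply/seteqP; split => [x []//|x /= e]; rewrite e.
rewrite (_ : _ `&` _ = set0) ?measure0//.
by apply/seteqP; split => x //= [Bx e]; move: Bi; rewrite -e Bx.
Qed.

End finite_partition.

Section plan_coupling.
Context {dX : measure_display} {X : measurableType dX} {R : realType} {I : finType}.
Variables (c : X -> I) (mu : {measure set X -> \bar R}) (nu : probability X R).
Hypothesis mc : forall i, measurable (c @^-1` [set i]).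
Hypothesis mu1 : mu setT = 1%E.
Variable pi : I -> I -> R.
Let a i := fine (mu (c @^-1` [set i])).
Let b i := fine (nu (c @^-1` [set i])).
Hypothesis pi_ge0 : forall i j, 0 <= pi i j.
Hypothesis pi_row : forall i, \sum_j pi i j = a i.
Hypothesis pi_col : forall j, \sum_i pi i j = b j.

Let Q i := c @^-1` [set i].
Let mQQ k : measurable (Q k.1 `*` Q k.2). Proof. by apply: measurableX; apply: mc. Qed.
Let mAQ A i : measurable A -> measurable (A `&` Q i).
Proof. by move=> mA; apply: measurableI => //; apply: mc. Qed.

Let a_ge0 i : 0 <= a i. Proof. by rewrite /a fine_ge0. Qed.
Let b_ge0 i : 0 <= b i. Proof. by rewrite /b fine_ge0. Qed.

Let muE A : measurable A -> mu A = (fine (mu A))%:E.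
Proof.
move=> mA; rewrite fineK// ge0_fin_numE// (@le_lt_trans _ _ 1%E) ?ltry//.
by rewrite -mu1; apply: le_measure => //; rewrite inE.
Qed.

Let nuE A : measurable A -> nu A = (fine (nu A))%:E.
Proof. by move=> mA; rewrite fineK// fin_num_measure. Qed.

Let w_subproof k : 0 <= pi k.1 k.2 / (a k.1 * b k.2).
Proof. by rewrite divr_ge0// mulr_ge0. Qed.

Let w k : {nonneg R} := NngNum (w_subproof k).

(** On each rectangle of cells the plan is the product measure, rescaled so that the rectangle has
    mass [pi k.1 k.2]. *)
Let piece (k : I * I) : {measure set (X * X) -> \bar R} :=
  mscale (w k) (mrestr (mu \x nu)%E (mQQ k)).

Let s := index_enum (I * I)%type.
Let k0 : I * I := (c point, c point).

(** [msum] sums measures indexed by natural numbers, hence the enumeration of the pairs; the default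
    [k0] is never reached for indices below [size s]. *)
Definition plan_measure : set (X * X) -> \bar R :=
  msum (fun n => piece (nth k0 s n)) (size s).

HB.instance Definition _ := Measure.on plan_measure.

Let plan_measureE A : (plan_measure A = \sum_k piece k A)%E.
Proof.
rewrite /plan_measure /= /msum /=.
by rewrite [RHS](big_nth k0) big_mkord.
Qed.

Let plan_measure_rect A B : measurable A -> measurable B ->
  plan_measure (A `*` B) =
  (\sum_i \sum_j pi i j / (a i * b j) * fine (mu (A `&` Q i)) * fine (nu (B `&` Q j)))%:E.
Proof.
move=> mA mB; rewrite plan_measureE pair_bigA /=.
rewrite -sumEFin; apply: eq_bigr => -[i j] _ /=.
rewrite /mscale /= /mrestr -setXI product_measure1E; [|exact: mAQ..].
rewrite [RHS]EFinM [(_ * fine _)%:E]EFinM -muleA.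
by congr (_ * (_ * _))%E; [exact: muE (mAQ i mA)|exact: nuE (mAQ j mB)].
Qed.

Let pi0l i j : a i = 0 -> pi i j = 0.
Proof.
move=> ai; have := pi_row i; rewrite ai => /psumr_eq0P; exact.
Qed.
Let pi0r i j : b j = 0 -> pi i j = 0.
Proof.
move=> bj; have := pi_col j; rewrite bj => /psumr_eq0P; exact.
Qed.

(** The cancellation survives a zero mass, because the marginal constraints force [pi i j = 0] as
    soon as [a i] or [b j] vanishes. *)
Let piK i j : pi i j / (a i * b j) * a i * b j = pi i j.
Proof.
have [ai|ai] := eqVneq (a i) 0; first by rewrite pi0l// !mul0r.
have [bj|bj] := eqVneq (b j) 0; first by rewrite pi0r// !mul0r.
by field; rewrite ai bj.
Qed.

Let plan_measureT : plan_measure setT = 1%E.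
Proof.
rewrite -setXTT plan_measure_rect//.
under eq_bigr do under eq_bigr do rewrite !setTI piK.
under eq_bigr do rewrite pi_row.
rewrite -sumEFin -mu1 (_ : [set: X] = [set x | predT (c x)]); last by apply/seteqP; split.
rewrite (measure_preimage_finType mc mu predT); apply: eq_bigr => i _.
by rewrite [RHS]muE.
Qed.

HB.instance Definition _ := Measure_isProbability.Build _ _ _ plan_measure plan_measureT.

Definition plan_coupling : probability (X * X)%type R := plan_measure.

Let restr_le (m : {measure set X -> \bar R}) A i : measurable A -> (m setT <= 1)%E ->
  fine (m (A `&` Q i)) <= fine (m (Q i)).
Proof.
move=> mA m1; have fin B : measurable B -> m B \is a fin_num.
  move=> mB; rewrite ge0_fin_numE// (@le_lt_trans _ _ 1%E) ?ltry//.
  by apply: le_trans m1; apply: le_measure => //; rewrite inE.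
apply: fine_le; [exact/fin/mAQ|exact/fin/mc|].
by apply: le_measure; rewrite ?inE; [exact: mAQ|exact: mc|exact: subIsetr].
Qed.

(** Cut [A] along the cells: inside cell [i] the plan has first marginal proportional to [mu], and
    the row sum [a i] fixes the factor to 1. *)
Lemma plan_coupling_fst A : measurable A -> plan_coupling (A `*` setT) = mu A.
Proof.
move=> mA; rewrite [LHS]plan_measure_rect//.
rewrite (measure_finType_partition mc mu mA) -sumEFin; apply: eq_bigr => i _.
rewrite muE; last exact: mAQ.
congr EFin; set m := fine _.
(* The upper bound serves the case [a i = 0], where it forces [m = 0]. *)
have [m0 ma] : 0 <= m /\ m <= a i by split; [by rewrite fine_ge0|apply: restr_le; rewrite ?mu1].
rewrite (eq_bigr (fun j => pi i j * (m / a i))) => [|j _].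
  rewrite -mulr_suml pi_row mulrC.
  have [ai|ai] := eqVneq (a i) 0; last by rewrite divfK.
  by rewrite ai mulr0; apply/eqP; rewrite eq_le m0 -ai ma.
rewrite setTI -/(b j).
have [bj|bj] := eqVneq (b j) 0; first by rewrite pi0r// !mul0r.
have [ai|ai] := eqVneq (a i) 0; first by rewrite pi0l// !mul0r.
by field; rewrite ai bj.
Qed.

Lemma plan_coupling_snd B : measurable B -> plan_coupling (setT `*` B) = nu B.
Proof.
move=> mB; rewrite [LHS]plan_measure_rect//.
rewrite (measure_finType_partition mc nu mB) exchange_big -sumEFin; apply: eq_bigr => j _.
rewrite [RHS](_ : _ = (fine (nu (B `&` Q j)))%:E); last exact: nuE (mAQ j mB).
congr EFin; set m := fine (nu (B `&` _)).
have [m0 mb] : 0 <= m /\ m <= b j.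
  by split; [by rewrite fine_ge0|exact: (restr_le j mB (probability_le1 nu measurableT))].
rewrite (eq_bigr (fun i => pi i j * (m / b j))) => [|i _].
  rewrite -mulr_suml pi_col mulrC.
  have [bj|bj] := eqVneq (b j) 0; last by rewrite divfK.
  by rewrite bj mulr0; apply/eqP; rewrite eq_le m0 -bj mb.
rewrite setTI -/(a i).
have [bj|bj] := eqVneq (b j) 0; first by rewrite pi0r// !mul0r.
have [ai|ai] := eqVneq (a i) 0; first by rewrite pi0l// !mul0r.
by field; rewrite ai bj.
Qed.

Lemma plan_coupling_rect i j : plan_coupling (Q i `*` Q j) = (pi i j)%:E.
Proof.
rewrite [LHS]plan_measure_rect; [congr EFin|exact: mc..].
have QI k k' : k' != k -> Q k `&` Q k' = set0.
  by move=> kk'; apply/seteqP; split => // x /= [e1 e2]; move: kk'; rewrite -e1 -e2 eqxx.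
rewrite (bigD1 i)//= (bigD1 j)//= !setIid -/(a i) -/(b j) piK.
rewrite big1 => [|k kj]; last by rewrite QI// measure0 mulr0.
rewrite addr0 big1 ?addr0// => k ki; rewrite big1// => k' _.
by rewrite QI// measure0 mulr0 mul0r.
Qed.

(** The cell-dependent part of the bound is integrated rectangle by rectangle, and the two copies of
    [g] depend on one coordinate each, so they only see the marginals. *)
Lemma integral_plan_coupling_le (h : X * X -> R) (cost : I -> I -> R) (g : X -> R) :
  (forall z, 0 <= h z) -> (forall i j, 0 <= cost i j) ->
  (forall x, 0 <= g x) -> measurable_fun setT g ->
  (forall x y, h (x, y) <= cost (c x) (c y) + g x + g y) ->
  (\int[plan_coupling]_z (h z)%:E <=
   (\sum_i \sum_j pi i j * cost i j)%:E
   + \int[mu]_x (g x)%:E + \int[nu]_x (g x)%:E)%E.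
Proof.
move=> h0 cost0 g0 mg hle.
(* [H] is the cell cost written as a combination of rectangle indicators, which makes it measurable
   and its integral explicit. *)
pose H (z : X * X) : R := \sum_i \sum_j cost i j * \1_(Q i `*` Q j) z.
have HE x y : H (x, y) = cost (c x) (c y).
  rewrite /H (bigD1 (c x))//= (bigD1 (c y))//= indicE mem_set ?mulr1; last by split.
  rewrite big1 => [|k kj]; last first.
    by rewrite indicE memNset ?mulr0// => -[/= _ e]; move: kj; rewrite -e eqxx.
  rewrite addr0 big1 ?addr0// => k ki; rewrite big1// => k' _.
  by rewrite indicE memNset ?mulr0// => -[/= e _]; move: ki; rewrite -e eqxx.
have mQ2 i j : measurable (Q i `*` Q j) := mQQ (i, j).
have mH : measurable_fun setT H.
  apply: measurable_sum => i; apply: measurable_sum => j.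
  by apply: measurable_funM => //; exact: measurable_indic.
have mg1 : measurable_fun setT (g \o fst : X * X -> R) by exact: measurableT_comp.
have mg2 : measurable_fun setT (g \o snd : X * X -> R) by exact: measurableT_comp.
have H0 z : 0 <= H z.
  by apply: sumr_ge0 => i _; apply: sumr_ge0 => j _; rewrite mulr_ge0.
apply: (@le_trans _ _ (\int[plan_coupling]_z ((H z)%:E + (g z.1)%:E + (g z.2)%:E))%E).
  apply: ge0_le_integral_nonmeasurable => z; first by rewrite lee_fin.
  by case: z => x y; rewrite -!EFinD lee_fin HE.
rewrite ge0_integralD//; last 4 first.
- by move=> z _; rewrite -EFinD lee_fin addr_ge0.
- by apply: emeasurable_funD; exact/measurable_EFinP.
- by move=> z _; rewrite lee_fin.
- exact/measurable_EFinP.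
rewrite ge0_integralD//; last 4 first.
- by move=> z _; rewrite lee_fin.
- exact/measurable_EFinP.
- by move=> z _; rewrite lee_fin.
- exact/measurable_EFinP.
have -> : (\int[plan_coupling]_z (g z.1)%:E = \int[mu]_x (g x)%:E)%E.
  rewrite -(@ge0_integral_pushforward _ _ _ _ _ fst measurable_fst plan_coupling setT
    (EFin \o g))//; [|exact/measurable_EFinP|by move=> x _; rewrite lee_fin].
  apply: eq_measure_integral => A mA _; rewrite -plan_coupling_fst//=.
  rewrite /pushforward (_ : fst @^-1` A = A `*` setT)//.
  by apply/seteqP; split => -[x y] //= [].
have -> : (\int[plan_coupling]_z (g z.2)%:E = \int[nu]_x (g x)%:E)%E.
  rewrite -(@ge0_integral_pushforward _ _ _ _ _ snd measurable_snd plan_coupling setT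
    (EFin \o g))//; [|exact/measurable_EFinP|by move=> x _; rewrite lee_fin].
  apply: eq_measure_integral => A mA _; transitivity (nu A) => //.
  rewrite -plan_coupling_snd//= /pushforward (_ : snd @^-1` A = setT `*` A)//.
  by apply/seteqP; split => -[x y] //= [].
rewrite leeD2r// leeD2r//.
under eq_integral do rewrite /H -sumEFin.
rewrite ge0_integral_sum//; last 2 first.
- move=> i; apply/measurable_EFinP; apply: measurable_sum => j.
  by apply: measurable_funM => //; exact: measurable_indic.
- by move=> i z _; rewrite lee_fin; apply: sumr_ge0 => j _; rewrite mulr_ge0.
rewrite -sumEFin le_eqVlt; apply/orP; left; apply/eqP; apply: eq_bigr => i _.
under eq_integral do rewrite -sumEFin.
rewrite ge0_integral_sum//; last 2 first.
- by move=> j; apply/measurable_EFinP; apply: measurable_funM => //; exact: measurable_indic.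
- by move=> j z _; rewrite lee_fin mulr_ge0.
rewrite -sumEFin; apply: eq_bigr => j _.
under eq_integral do rewrite EFinM.
rewrite ge0_integralZl_EFin//; last 1 first.
- by apply/measurable_EFinP; exact: measurable_indic.
by rewrite integral_indic// setIT [X in (_ * X)%E]plan_coupling_rect -EFinM mulrC.
Qed.

End plan_coupling.

(** * Euclidean norm and dyadic grid *)

(** Convexity of t^p at the midpoint of [a] and [b], multiplied by 2^p. *)
Lemma powRD_le (R : realType) (a b p : R) : 0 <= a -> 0 <= b -> 1 <= p ->
  (a + b) `^ p <= 2 `^ (p - 1) * (a `^ p + b `^ p).
Proof.
move=> a0 b0 p1.
have h0 : 0 <= 2^-1 :> R by lra.
have h1 : 2^-1 <= 1 :> R by lra.
pose t := Itv01 h0 h1.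
have ct (u v : R^o) : conv t u v = 2^-1 * (u + v).
  by rewrite convRE/= /onem mulrDr; congr (_ * _ + _ * _); lra.
have H : (2^-1 * (a + b)) `^ p <= 2^-1 * (a `^ p + b `^ p).
  rewrite -!ct; apply: (convex_powR p1 t); rewrite inE/= in_itv/= ?a0 ?b0//.
have two0 : (2 : R) != 0 by [].
have -> : a + b = 2 * (2^-1 * (a + b)) by field.
rewrite powRM ?mulr_ge0 ?addr_ge0//.
have -> : 2 `^ (p - 1) = 2 `^ p * 2^-1.
  by rewrite powRB ?two0 ?implybT// powRr1.
by rewrite -mulrA ler_wpM2l ?powR_ge0.
Qed.

Section euclidean_norm.
Context {R : realType} {d : nat}.
Implicit Types x y : Rd R d.

Lemma enorm_ge0 x : 0 <= enorm x. Proof. exact: sqrtr_ge0. Qed.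
Lemma euclidean_dist_ge0 x y : 0 <= Defs.edist x y. Proof. exact: sqrtr_ge0. Qed.

Lemma sqr_enorm x : enorm x ^+ 2 = \sum_(i < d) tnth x i ^+ 2.
Proof. by rewrite sqr_sqrtr// sumr_ge0// => i _; rewrite sqr_ge0. Qed.

Lemma norm_tnth_le_enorm x i : `|tnth x i| <= enorm x.
Proof.
rewrite -sqrtr_sqr ler_wsqrtr// (bigD1 i)//= lerDl sumr_ge0// => j _.
exact: sqr_ge0.
Qed.

(** Expand the nonnegative sum of squares of |y| x_i + |x| y_i and divide by 2|x||y|; a zero norm is
    treated apart. The sign is the one that occurs in the expansion of the squared norm of x - y. *)
Lemma Cauchy_Schwarz_enorm x y :
  - (\sum_(i < d) tnth x i * tnth y i) <= enorm x * enorm y.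
Proof.
have [x0|x0] := eqVneq (enorm x) 0.
  rewrite x0 mul0r big1 ?oppr0// => i _.
  have := norm_tnth_le_enorm x i; rewrite x0 normr_le0 => /eqP ->.
  by rewrite mul0r.
have xp : 0 < enorm x by rewrite lt0r x0 enorm_ge0.
have H : 0 <= \sum_(i < d) (enorm y * tnth x i + enorm x * tnth y i) ^+ 2.
  by apply: sumr_ge0 => i _; exact: sqr_ge0.
have E : \sum_(i < d) (enorm y * tnth x i + enorm x * tnth y i) ^+ 2 =
    enorm y ^+ 2 * enorm x ^+ 2 + enorm x ^+ 2 * enorm y ^+ 2 +
    2 * (enorm x * enorm y) * \sum_(i < d) tnth x i * tnth y i.
  rewrite [in X in _ * X + _]sqr_enorm [in X in _ + _ * X + _]sqr_enorm.
  by rewrite !mulr_sumr -!big_split/=; apply: eq_bigr => i _; ring.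
rewrite E in H.
have [y0|y0] := eqVneq (enorm y) 0.
  rewrite y0 mulr0 big1 ?oppr0// => i _.
  have := norm_tnth_le_enorm y i; rewrite y0 normr_le0 => /eqP ->.
  by rewrite mulr0.
have yp : 0 < enorm y by rewrite lt0r y0 enorm_ge0.
have xy : 0 < enorm x * enorm y by rewrite mulr_gt0.
rewrite -(ler_pM2l xy); move: H; set S := \sum_(i < d) _; lra.
Qed.

Lemma euclidean_dist_le_enormD x y : Defs.edist x y <= enorm x + enorm y.
Proof.
have h0 : 0 <= enorm x + enorm y by rewrite addr_ge0 ?enorm_ge0.
rewrite -(ger0_norm h0) -sqrtr_sqr ler_wsqrtr// sqrrD !sqr_enorm.
have CS := Cauchy_Schwarz_enorm x y.
rewrite [leLHS](_ : _ = \sum_(i < d) tnth x i ^+ 2 +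
    \sum_(i < d) tnth y i ^+ 2 - (\sum_(i < d) tnth x i * tnth y i) *+ 2); first by lra.
rewrite -sumrMnl -big_split/= -sumrB; apply: eq_bigr => i _; ring.
Qed.

Lemma euclidean_dist_le_coord x y e : 0 <= e ->
  (forall i, `|tnth x i - tnth y i| <= e) -> Defs.edist x y <= Num.sqrt d%:R * e.
Proof.
move=> e0 h; rewrite -(ger0_norm e0) -(sqrtr_sqr e) -sqrtrM// ler_wsqrtr//.
rewrite mulr_natl -[d in leRHS]card_ord -sumr_const; apply: ler_sum => i _.
by rewrite -(real_normK (num_real _)) lerXn2r ?nnegrE.
Qed.

Lemma measurable_enorm : measurable_fun setT (@enorm R d).
Proof.
rewrite (_ : @enorm R d = fun x => (\sum_(i < d) tnth x i ^+ 2) `^ 2^-1); last first.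
  by apply/funext => x; rewrite powR12_sqrt// sumr_ge0// => i _; exact: sqr_ge0.
apply: (measurableT_comp (measurable_powR _)).
apply: measurable_sum => i; apply: measurable_funX; exact: measurable_tnth.
Qed.

End euclidean_norm.

(* Points outside [-K, K] are assigned to the outermost grid intervals, so that
   the cells partition the whole space. *)
Definition grid_index {R : realType} (K : R) (N : nat) (t : R) : nat :=
  minn N.-1 (Num.truncn (N%:R * (t + K) / (2 * K))).

Section grid.
Context {R : realType}.
Variable K : R.
Hypothesis K0 : 0 < K.

Lemma grid_index_lt N t : (0 < N)%N -> (grid_index K N t < N)%N.
Proof. by move=> N0; rewrite (leq_ltn_trans (geq_minl _ _))// prednK. Qed.

(** A level set is the difference of two superlevel sets, each of which is everything, empty, or the
    preimage of a half-line under an affine map. *)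
Lemma measurable_grid_index N m : measurable [set t : R | grid_index K N t = m].
Proof.
pose y (t : R) : R := N%:R * (t + K) / (2 * K).
have my : measurable_fun setT y.
  apply: measurable_funM => //; apply: measurable_funM => //.
  exact: measurable_funD.
have mle k : measurable [set t : R | (k <= grid_index K N t)%N].
  case: k => [|k]; first by rewrite (_ : [set _ | _] = setT)//; apply/seteqP; split.
  have [kN|kN] := ltnP k N.-1.
    rewrite (_ : [set _ | _] = setT `&` y @^-1` `[k.+1%:R, +oo[).
      by apply: my.
    apply/seteqP; split => t /=; rewrite /grid_index leq_min kN/= truncn_gt_nat in_itv/= andbT//.
    by case.
  rewrite (_ : [set _ | _] = set0)//; apply/seteqP; split => t //=.
  by rewrite /grid_index leq_min ltnNge kN.
rewrite (_ : [set _ | _] = [set t | (m <= grid_index K N t)%N] `\`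
    [set t | (m.+1 <= grid_index K N t)%N]).
  exact: measurableD.
apply/seteqP; split => t /=; first by move=> ->; rewrite ltnn.
by move=> [h /negP]; rewrite -leqNgt => h'; apply/eqP; rewrite eqn_leq h h'.
Qed.

(** Equal quotients by [u] put both points in the same block of [u] consecutive intervals of length
    2K/N. *)
Lemma grid_index_close N u t t' : (0 < N)%N -> (0 < u)%N -> `|t| < K -> `|t'| < K ->
  (grid_index K N t %/ u = grid_index K N t' %/ u)%N ->
  `|t - t'| <= 2 * K * u%:R / N%:R.
Proof.
move=> N0 u0.
have NR : 0 < N%:R :> R by rewrite ltr0n.
pose y (t : R) : R := N%:R * (t + K) / (2 * K).
have yP s : `|s| < K ->
    (grid_index K N s %/ u * u)%:R <= y s <= ((grid_index K N s %/ u).+1 * u)%:R.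
  rewrite ltr_norml => /andP[s1 s2].
  have y0 : 0 <= y s by rewrite /y divr_ge0 ?mulr_ge0 ?(ltW K0)//; lra.
  have yN : y s < N%:R.
    rewrite /y ltr_pdivrMr ?mulr_gt0// ltr_pM2l//; lra.
  (* Strictly inside the cube [y s < N%:R], so the clamping by [minn] has no effect. *)
  have e : grid_index K N s = Num.truncn (y s).
    rewrite /grid_index -/(y s); apply/minn_idPr.
    by rewrite -ltnS prednK// truncn_lt_nat.
  have /andP[h1 h2] := truncn_itv y0.
  rewrite e; apply/andP; split.
    by apply: le_trans h1; rewrite ler_nat leq_divM.
  by apply: (le_trans (ltW h2)); rewrite ler_nat ltn_ceil.
move=> /yP h /yP h' e; move: h h'; rewrite e mulSn natrD.
set k := (_ * u)%:R => /andP[h1 h2] /andP[h3 h4].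
have -> : t - t' = (y t - y t') * (2 * K / N%:R).
  by rewrite /y; field; rewrite !gt_eqF.
have c0 : 0 <= 2 * K / N%:R by rewrite divr_ge0 ?mulr_ge0 ?(ltW K0)// ltW.
rewrite normrM (ger0_norm c0) [leRHS](_ : _ = u%:R * (2 * K / N%:R)); last by field; rewrite gt_eqF.
by rewrite ler_wpM2r// ler_norml; apply/andP; split; lra.
Qed.

Context {d : nat}.

Definition grid_cell L (x : Rd R d) : {ffun 'I_d -> 'I_(2 ^ L)} :=
  [ffun i => Ordinal (grid_index_lt (tnth x i) (expn_gt0 2 L))].

Lemma dyadic_ancestor_proof L l (j : 'I_(2 ^ L)) : (j %/ 2 ^ (L - l) < 2 ^ l)%N.
Proof.
rewrite ltn_divLR ?expn_gt0// -expnD (leq_trans (ltn_ord j))// leq_exp2l//.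
by rewrite -leq_subLR.
Qed.

(** Dividing by a power of 2 drops the last [L - l] binary digits of each coordinate. For [l > L]
    the truncated difference is 0 and the index is only retyped; the map is thus defined at all
    levels, as [exists_multiscale_plan] asks. *)
Definition dyadic_ancestor L l (i : {ffun 'I_d -> 'I_(2 ^ L)}) :
    {ffun 'I_d -> 'I_(2 ^ l)} :=
  [ffun k => Ordinal (dyadic_ancestor_proof l (i k))].

Lemma dyadic_ancestor_nested L k l (i i' : {ffun 'I_d -> 'I_(2 ^ L)}) : (k <= l)%N ->
  dyadic_ancestor l i = dyadic_ancestor l i' ->
  dyadic_ancestor k i = dyadic_ancestor k i'.
Proof.
move=> kl /ffunP h; apply/ffunP => j; have := h j; rewrite !ffunE => -[e].
apply/val_inj => /=.
have -> : (2 ^ (L - k) = 2 ^ (L - l) * 2 ^ ((L - k) - (L - l)))%N.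
  by rewrite -expnD subnKC// leq_sub2l.
by rewrite !divnMA e.
Qed.

Lemma dyadic_ancestor0 L (i i' : {ffun 'I_d -> 'I_(2 ^ L)}) :
  dyadic_ancestor 0 i = dyadic_ancestor 0 i'.
Proof. by apply/ffunP => j; apply: ord_inj; rewrite !ord1. Qed.

Lemma card_dyadic l : #|{ffun 'I_d -> 'I_(2 ^ l)}| = (2 ^ (l * d))%N.
Proof. by rewrite card_ffun !card_ord expnM. Qed.

Lemma measurable_grid_cell L i : measurable (@grid_cell L @^-1` [set i]).
Proof.
rewrite (_ : _ @^-1` _ = \bigcap_(k in [set: 'I_d])
    (fun x => tnth x k) @^-1` [set t | grid_index K (2 ^ L) t = i k]).
  apply: fin_bigcap_measurable => // k _; rewrite -[X in measurable X]setTI.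
  by apply: (measurable_tnth k) => //; exact: measurable_grid_index.
apply/seteqP; split => x /=; first by move=> <- k _ /=; rewrite ffunE.
by move=> h; apply/ffunP => k; apply: val_inj; rewrite ffunE/=; exact: h.
Qed.

Lemma grid_cell_diameter L l (x y : Rd R d) : (l <= L)%N ->
  enorm x < K -> enorm y < K ->
  dyadic_ancestor l (grid_cell L x) = dyadic_ancestor l (grid_cell L y) ->
  Defs.edist x y <= 2 * K * Num.sqrt d%:R / 2 ^+ l.
Proof.
move=> lL xK yK /ffunP e.
rewrite [leRHS](_ : _ = Num.sqrt d%:R * (2 * K / 2 ^+ l)); last first.
  by rewrite [RHS]mulrA [Num.sqrt _ * _]mulrC.
apply: euclidean_dist_le_coord => [|k]; first by rewrite divr_ge0 ?mulr_ge0 ?(ltW K0)// exprn_ge0.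
have := e k; rewrite !ffunE => -[ek].
have h := grid_index_close (expn_gt0 2 L) (expn_gt0 2 (L - l))
  (le_lt_trans (norm_tnth_le_enorm x k) xK) (le_lt_trans (norm_tnth_le_enorm y k) yK) ek.
apply: (le_trans h); rewrite le_eqVlt; apply/orP; left; apply/eqP.
rewrite !natrX -[in X in _ / X](subnK lL) exprD; field.
by rewrite !expf_neq0.
Qed.

End grid.

(** * Transport cost of the dyadic coupling *)

(** Hoelder's inequality for h^p and the indicator of [A], with the conjugate exponents q/p and
    q/(q-p). *)
Lemma hoelder_truncated_moment (dX : measure_display) (X : measurableType dX) (R : realType)
    (xi : probability X R) (h : X -> R) (A : set X) (p q : R) :
  0 < p -> p < q -> measurable_fun setT h -> (forall x, 0 <= h x) -> measurable A ->
  (\int[xi]_x (h x `^ q)%:E < +oo)%E ->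
  (\int[xi]_x (\1_A x * h x `^ p)%:E <=
   (fine (xi A) `^ ((q - p) / q) * fine (\int[xi]_x (h x `^ q)%:E) `^ (p / q))%:E)%E.
Proof.
move=> p0 pq mh h0 mA hfin; have q0 : 0 < q by exact: lt_trans pq.
have r0 : 0 < q / p by rewrite divr_gt0.
have s0 : 0 < q / (q - p) by rewrite divr_gt0// subr_gt0.
have rs : (q / p)^-1 + (q / (q - p))^-1 = 1.
  by rewrite !invf_div -mulrDl subrKC divff// gt_eqF.
have mhp : measurable_fun setT (fun x => h x `^ p).
  exact: (measurableT_comp (measurable_powR _)).
have mi : measurable_fun setT (\1_A : X -> R) by exact: measurable_indic.
have := @hoelder _ _ _ xi (fun x => h x `^ p) (\1_A) _ _ mhp mi r0 s0 rs.
rewrite Lnorm1 unlock /=.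
have -> : (\int[xi]_x (`|h x `^ p * \1_A x|)%:E = \int[xi]_x (\1_A x * h x `^ p)%:E)%E.
  by apply: eq_integral => x _; rewrite ger0_norm ?mulr_ge0 ?powR_ge0// mulrC.
have -> : (\int[xi]_x (`|h x `^ p| `^ (q / p))%:E = \int[xi]_x (h x `^ q)%:E)%E.
  apply: eq_integral => x _; rewrite ger0_norm ?powR_ge0// -powRrM.
  by rewrite mulrCA divff ?mulr1// gt_eqF.
have -> : (\int[xi]_x (`|\1_A x : R| `^ (q / (q - p)))%:E = xi A)%E.
  rewrite -[in RHS](setIT A) -(integral_indic xi measurableT mA).
  apply: eq_integral => x _; rewrite indicE; case: (_ \in _); rewrite ?normr1 ?powR1//.
  by rewrite normr0 powR0// gt_eqF.
rewrite !invf_div => /le_trans; apply.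
have hf : (\int[xi]_x (h x `^ q)%:E)%E \is a fin_num.
  by rewrite ge0_fin_numE// integral_ge0// => x _; rewrite lee_fin powR_ge0.
rewrite -(fineK hf) -(@fineK _ (xi A)) ?fin_num_measure//.
by rewrite !poweR_EFin -EFinM mulrC.
Qed.

Section dyadic_coupling.
Context {R : realType} {d : nat}.
Variables (p K : R) (L : nat).
Hypotheses (p1 : 1 <= p) (K0 : 0 < K).

Definition dyadic_set l (j : {ffun 'I_d -> 'I_(2 ^ l)}) : set (Rd R d) :=
  [set x | dyadic_ancestor l (grid_cell K L x) == j].

Definition dyadic_cost l : R := (2 * K * Num.sqrt d%:R / 2 ^+ l) `^ p.

Definition outer_cost (x : Rd R d) : R :=
  2 `^ (p - 1) * (\1_(~` open_ball0 K) x * (enorm x `^ p + K `^ p)).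

Lemma measurable_dyadic_set l j : measurable (@dyadic_set l j).
Proof.
apply: (measurable_preimage_finType (measurable_grid_cell K (L:=L))
  (fun i => dyadic_ancestor l i == j)).
Qed.

Lemma measurable_open_ball0 : measurable (open_ball0 K : set (Rd R d)).
Proof.
rewrite (_ : open_ball0 K = setT `&` enorm @^-1` `]-oo, K[).
  by apply: measurable_enorm.
by apply/seteqP; split => x /=; rewrite /open_ball0/= in_itv/=; [split|case].
Qed.

Lemma measurable_outer_cost : measurable_fun setT outer_cost.
Proof.
apply: measurable_funM => //; apply: measurable_funM.
  by apply: measurable_indic; apply: measurableC; exact: measurable_open_ball0.
apply: measurable_funD => //.
exact: (measurableT_comp (measurable_powR _) measurable_enorm).
Qed.

Lemma outer_cost_ge0 x : 0 <= outer_cost x.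
Proof. by rewrite /outer_cost !mulr_ge0 ?addr_ge0 ?powR_ge0. Qed.

Lemma dyadic_cost_ge0 l : 0 <= dyadic_cost l.
Proof. exact: powR_ge0. Qed.

(** When just one of the points is outside the ball, the p-th power of the norm of the inner point
    is at most K^p and is charged to the outer one; this is the origin of the summand K^p in
    [outer_cost]. *)
Lemma euclidean_dist_powR_le_outer x y : ~ (enorm x < K /\ enorm y < K) ->
  Defs.edist x y `^ p <= outer_cost x + outer_cost y.
Proof.
move=> xy; have p0 : 0 <= p by exact: le_trans p1.
have H1 : Defs.edist x y `^ p <= 2 `^ (p - 1) * (enorm x `^ p + enorm y `^ p).
  apply: le_trans (powRD_le (enorm_ge0 x) (enorm_ge0 y) p1).
  apply: ge0_ler_powR => //; [exact: euclidean_dist_ge0| |exact: euclidean_dist_le_enormD].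
  by rewrite nnegrE addr_ge0 ?enorm_ge0.
apply: (le_trans H1); rewrite /outer_cost -mulrDr ler_wpM2l ?powR_ge0//.
have ex := powR_ge0 (enorm x) p; have ey := powR_ge0 (enorm y) p; have eK := powR_ge0 K p.
have small z : enorm z < K -> enorm z `^ p <= K `^ p.
  by move=> zK; apply: ge0_ler_powR => //; [exact: enorm_ge0|exact: ltW|exact: ltW].
rewrite !indicE; have [xK|xK] := boolP (x \in ~` open_ball0 K);
  have [yK|yK] := boolP (y \in ~` open_ball0 K); rewrite ?mul1r ?mul0r ?addr0 ?add0r.
- by rewrite lerD// lerDl.
- by move: yK; rewrite notin_setE /= /open_ball0 /= => /contrapT/small; rewrite lerD2l.
- move: xK; rewrite notin_setE /= /open_ball0 /= => /contrapT/small.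
  by rewrite addrC lerD2l.
- move: xK yK; rewrite !notin_setE /= /open_ball0 /= => /contrapT ? /contrapT ?.
  by exfalso; apply: xy.
Qed.

(** The cheapest [dyadic_cost] among the levels at which two cells share an ancestor. It depends on
    cells only, as the discrete plan requires, and dominates the true cost for points of the ball.
    The default value is harmless since level 0 is always shared. *)
Let cost (i i' : {ffun 'I_d -> 'I_(2 ^ L)}) : R :=
  \big[Num.min/dyadic_cost 0]_(l < L.+1 | dyadic_ancestor l i == dyadic_ancestor l i')
    dyadic_cost l.

Let cost_le l i i' : (l <= L)%N ->
  dyadic_ancestor l i = dyadic_ancestor l i' -> cost i i' <= dyadic_cost l.
Proof.
move=> lL e; apply: (@bigmin_le_cond _ _ _ _ (Ordinal (lL : (l < L.+1)%N))
  (fun l : 'I_L.+1 => dyadic_ancestor l i == dyadic_ancestor l i')) => /=.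
by rewrite e.
Qed.

Let edist_le_cost x y : enorm x < K -> enorm y < K ->
  Defs.edist x y `^ p <= cost (grid_cell K L x) (grid_cell K L y).
Proof.
move=> xK yK.
have H l : (l <= L)%N ->
    dyadic_ancestor l (grid_cell K L x) = dyadic_ancestor l (grid_cell K L y) ->
    Defs.edist x y `^ p <= dyadic_cost l.
  move=> lL e; have h := grid_cell_diameter K0 lL xK yK e.
  apply: ge0_ler_powR => //; rewrite ?nnegrE ?euclidean_dist_ge0//; first exact: le_trans p1.
  exact: le_trans (euclidean_dist_ge0 _ _) h.
apply/bigmin_geP; split; first by apply: H => //; exact: dyadic_ancestor0.
by move=> l /eqP e; apply: H => //; rewrite -ltnS.
Qed.

(** [plan_coupling] turns the multiscale plan between cell masses into a coupling. Its cost is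
    bounded pointwise by [cost] if both points lie in the ball and by [outer_cost] otherwise. *)
Lemma wasserstein_pow_le_dyadic (mu : {measure set Rd R d -> \bar R})
    (nu : probability (Rd R d) R) : mu setT = 1%E ->
  (wasserstein_pow p mu nu <=
   (dyadic_cost L + \sum_(l < L) dyadic_cost l * \sum_j
      `|fine (mu (dyadic_set (l := l.+1) j)) - fine (nu (dyadic_set (l := l.+1) j))|)%:E
   + \int[mu]_x (outer_cost x)%:E + \int[nu]_x (outer_cost x)%:E)%E.
Proof.
move=> mu1.
pose c := @grid_cell R K d L.
have mc := @measurable_grid_cell R K d L.
pose a i := fine (mu (c @^-1` [set i])); pose b i := fine (nu (c @^-1` [set i])).
have finmu A : measurable A -> mu A \is a fin_num.
  move=> mA; rewrite ge0_fin_numE// (@le_lt_trans _ _ 1%E) ?ltry//.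
  by rewrite -mu1; apply: le_measure => //; rewrite inE.
have sumE (m : {measure set Rd R d -> \bar R}) B : (forall A, measurable A -> m A \is a fin_num) ->
    \sum_(i | B i) fine (m (c @^-1` [set i])) = fine (m [set x | B (c x)]).
  move=> fm; rewrite (measure_preimage_finType mc m B).
  rewrite (eq_bigr (fun i => (fine (m (c @^-1` [set i])))%:E)) ?sumEFin// => i _.
  by rewrite fineK// fm//; exact: mc.
have cT : [set x | predT (c x)] = setT by apply/seteqP; split.
have sa : \sum_i a i = 1 by rewrite (sumE mu predT finmu) cT mu1.
have finnu A : measurable A -> nu A \is a fin_num by move=> mA; exact: fin_num_measure.
have sb : \sum_i b i = 1.
  transitivity (fine (nu setT)); last by rewrite probability_setT.
  by rewrite -cT; exact: sumE nu predT finnu.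
have ab : \sum_i a i = \sum_i b i by rewrite sa sb.
have a0 i : 0 <= a i by exact: fine_ge0.
have b0 i : 0 <= b i by exact: fine_ge0.
have [pi [pi0 row col pic]] := @exists_multiscale_plan R _ _
  (fun l => @dyadic_ancestor d L l) L a b cost dyadic_cost
  (@dyadic_ancestor_nested d L) (@dyadic_ancestor0 d L) dyadic_cost_ge0 cost_le a0 b0 ab.
have cost0 i i' : 0 <= cost i i'.
  by apply/bigmin_geP; split => [|? _]; exact: dyadic_cost_ge0.
pose gam := plan_coupling mc mu1 pi0 row col.
apply: (@le_trans _ _ (\int[gam]_z (Defs.edist z.1 z.2 `^ p)%:E)%E).
  apply: ereal_inf_lbound; exists gam => // A mA; split.
    exact: plan_coupling_fst.
  exact: plan_coupling_snd.
have := @integral_plan_coupling_le _ _ _ _ c mu nu mc mu1 pi pi0 row col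
  (fun z => Defs.edist z.1 z.2 `^ p) cost outer_cost.
have h1 (z : Rd R d * Rd R d) : 0 <= Defs.edist z.1 z.2 `^ p by exact: powR_ge0.
have h2 x y : Defs.edist x y `^ p <= cost (c x) (c y) + outer_cost x + outer_cost y.
  have [[xK yK]|nxy] := pselect (enorm x < K /\ enorm y < K).
    by rewrite -addrA (le_trans (edist_le_cost xK yK))// lerDl addr_ge0 ?outer_cost_ge0.
  by rewrite -addrA (le_trans (euclidean_dist_powR_le_outer nxy))// lerDr.
move=> /(_ h1 cost0 outer_cost_ge0 measurable_outer_cost h2) /le_trans; apply.
rewrite leeD2r// leeD2r// lee_fin (le_trans pic)// sa mulr1 lerD2l ler_sum// => l _.
rewrite ler_wpM2l ?dyadic_cost_ge0// le_eqVlt; apply/orP; left; apply/eqP.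
apply: eq_bigr => j _; congr (`|_ - _|).
  exact: (sumE mu (fun i => dyadic_ancestor l.+1 i == j) finmu).
exact: (sumE nu (fun i => dyadic_ancestor l.+1 i == j) finnu).
Qed.

End dyadic_coupling.

(** * Choice of the scale *)

Section multiscale_sum.
Context {R : realType}.

Lemma sum_expr_le (r : R) L : 2 <= r -> \sum_(l < L) r ^+ l.+1 <= 2 * r ^+ L.
Proof.
move=> r2; have r0 : 0 <= r by lra.
elim: L => [|L IH]; first by rewrite big_ord0 expr0 mulr1.
rewrite big_ord_recr/=; apply: (le_trans (lerD IH (lexx _))).
have h : 2 * r ^+ L <= r ^+ L.+1 by rewrite exprS ler_wpM2r// exprn_ge0.
lra.
Qed.

(** The level terms grow geometrically with ratio r = 2^(d-p), and r >= 2 because d - p > p >= 1.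
    The finest level therefore dominates, and [2 ^+ L <= x] bounds it by a multiple of x^(-p); the
    diameter term is of the same order by [x < 2 ^+ L.+1]. *)
Lemma dyadic_scale_sum_le (p x B : R) (d L : nat) (K : R) :
  1 <= p -> p < d%:R / 2 -> 0 < K -> 0 <= B ->
  2 ^+ L <= x -> x < 2 ^+ L.+1 ->
  @dyadic_cost R d p K L + \sum_(l < L) @dyadic_cost R d p K l *
     ((2 ^ (l.+1 * d))%:R * (B * x `^ (- d%:R))) <=
  (2 * K * Num.sqrt d%:R) `^ p * (2 `^ p * x `^ (- p) * (1 + 2 * B)).
Proof.
move=> p1 pd K0 B0 Lx xL.
have x0 : 0 < x by apply: lt_le_trans Lx; rewrite exprn_gt0.
set D0 := (_ `^ p).
have D00 : 0 <= D0 by exact: powR_ge0.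
have two0 : (2 : R) != 0 by [].
have powX l : (2 ^+ l : R) `^ p = (2 `^ p) ^+ l.
  by rewrite -(powR_mulrn l (ler0n R 2)) powRAC powR_mulrn ?powR_ge0.
have DE l : @dyadic_cost R d p K l = D0 * ((2 `^ p) ^+ l)^-1.
  rewrite /dyadic_cost powRM ?invr_ge0 ?exprn_ge0 ?mulr_ge0 ?sqrtr_ge0 ?(ltW K0)//.
  congr (_ * _); rewrite -powR_inv1 ?exprn_ge0// -powRrM mulrC powRrM.
  by rewrite powR_inv1 ?powR_ge0// powX.
pose r : R := 2 `^ (d%:R - p).
have r2 : 2 <= r.
  rewrite -[leLHS](powRr1 (ler0n _ 2)) /r ler_powR ?ler1n//; lra.
have two_d : 2 `^ p * r = 2 ^+ d.
  by rewrite -powRD ?two0 ?implybT// subrKC powR_mulrn.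
have pn0 : 2 `^ p != 0 :> R by rewrite gt_eqF// powR_gt0.
have termE l : @dyadic_cost R d p K l * ((2 ^ (l.+1 * d))%:R * (B * x `^ (- d%:R))) =
    D0 * 2 `^ p * B * x `^ (- d%:R) * r ^+ l.+1.
  rewrite DE natrX mulnC exprM -two_d exprMn [(2 `^ p) ^+ l.+1]exprS; field.
  by rewrite expf_neq0.
rewrite (eq_bigr _ (fun (l : 'I_L) _ => termE l)) -mulr_sumr DE.
have HL : r ^+ L <= x `^ (d%:R - p).
  rewrite /r -powR_mulrn ?powR_ge0// -powRrM mulrC powRrM powR_mulrn ?ler0n//.
  apply: ge0_ler_powR => //; first by lra.
  - by rewrite nnegrE exprn_ge0.
  - by rewrite nnegrE ltW.
have xE : x `^ (- d%:R) * x `^ (d%:R - p) = x `^ (- p).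
  by rewrite -powRD ?(lt0r_neq0 x0) ?implybT// addKr.
have H1 : ((2 `^ p) ^+ L)^-1 <= 2 `^ p * x `^ (- p).
  rewrite powRN -lef_pV2 ?posrE ?invr_gt0 ?mulr_gt0 ?invr_gt0 ?exprn_gt0 ?powR_gt0//.
  rewrite invrK invfM invrK mulrC ler_pdivrMr ?powR_gt0// -exprSr -powX.
  by apply: ge0_ler_powR => //; rewrite ?nnegrE ?exprn_ge0 ?(ltW x0) ?(ltW xL)//; lra.
have H2 : x `^ (- d%:R) * \sum_(l < L) r ^+ l.+1 <= 2 * x `^ (- p).
  rewrite -xE mulrCA ler_wpM2l ?powR_ge0//.
  by apply: (le_trans (sum_expr_le L r2)); rewrite ler_pM2l.
set S := \sum_(l < L) _ in H2 *.
have := ler_wpM2l D00 H1.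
have := ler_wpM2l (mulr_ge0 (mulr_ge0 D00 (powR_ge0 2 p)) B0) H2.
set u := (_ ^+ L)^-1; set v := x `^ (- p); set w := x `^ (- d%:R); set t := 2 `^ p.
rewrite (_ : D0 * t * B * (w * S) = D0 * t * B * w * S); last by ring.
lra.
Qed.

Lemma exists_dyadic_scale (n d : nat) : (0 < n)%N -> (0 < d)%N ->
  exists L : nat, 2 ^+ L <= (n%:R : R) `^ (2 * d%:R)^-1 < 2 ^+ L.+1.
Proof.
move=> n0 d0; have b1 : (1 < 2 ^ (2 * d))%N by rewrite -(expn0 2) ltn_exp2l// muln_gt0.
(* [L] is the integer logarithm of [n] in base 2^(2d); taking roots of order 2d then gives both
   bounds. *)
have /andP[h1 h2] := trunc_log_bounds b1 n0.
exists (trunc_log (2 ^ (2 * d)) n); set L := trunc_log _ _ in h1 h2 *.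
have e0 : 0 < (2 * d%:R : R)^-1 by rewrite invr_gt0 mulr_gt0// ltr0n.
have E l : (2 ^+ l : R) = ((2 ^ (2 * d)) ^ l)%:R `^ (2 * d%:R)^-1.
  rewrite -expnM natrX -(powR_mulrn (2 * d * l) (ler0n R 2)) -powRrM.
  rewrite (_ : _ * _^-1 = l%:R) ?powR_mulrn// !natrM; field.
  by rewrite pnatr_eq0 -lt0n.
rewrite !E; apply/andP; split.
  by apply: ge0_ler_powR; rewrite ?nnegrE ?ler0n ?ler_nat// ltW.
by apply: gt0_ltr_powR; rewrite ?nnegrE ?ler0n ?ltr_nat.
Qed.

End multiscale_sum.

(** * Expected transport cost of the empirical measure *)

Lemma wasserstein_pow_ge0 (R : realType) (d : nat) (p : R)
    (mu nu : {measure set Rd R d -> \bar R}) : (0 <= wasserstein_pow p mu nu)%E.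
Proof.
apply: le_ereal_inf_tmp => _ [gam _ <-].
by apply: integral_ge0 => z _; rewrite lee_fin powR_ge0.
Qed.

Section empirical.
Context {dT dX : measure_display} {T : measurableType dT} {X : measurableType dX}
  {R : realType} {P : probability T R}.
Variables (U : nat -> {RV P >-> X}) (xi : probability X R).
Hypothesis U_xi : forall i (A : set X), measurable A -> distribution P (U i) A = xi A.

Lemma empirical_measureE n w A :
  empirical_measure U n w A = (n%:R^-1 * \sum_(i < n) \1_(U i @^-1` A) w)%:E.
Proof.
rewrite /empirical_measure /= /mscale /= /msum EFinM; congr (_ * _)%E.
rewrite -sumEFin; apply: eq_bigr => i _; by rewrite /= diracE indicE.
Qed.

Lemma empirical_measureT n w : (0 < n)%N -> empirical_measure U n w setT = 1%E.
Proof.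
move=> n0; rewrite empirical_measureE; congr EFin.
rewrite (eq_bigr (fun=> 1)) => [|i _]; last by rewrite indicE in_setT.
by rewrite sumr_const card_ord mulVf// pnatr_eq0 -lt0n.
Qed.

Lemma integral_empirical_measure n w (g : X -> R) : measurable_fun setT g ->
  (forall x, 0 <= g x) ->
  (\int[empirical_measure U n w]_x (g x)%:E = (n%:R^-1 * \sum_(i < n) g (U i w))%:E)%E.
Proof.
move=> mg g0; rewrite /empirical_measure ge0_integral_mscale//; last 2 first.
- exact/measurable_EFinP.
- by move=> x _; rewrite lee_fin.
rewrite ge0_integral_measure_sum//; last 2 first.
- by move=> x _; rewrite lee_fin.
- exact/measurable_EFinP.
rewrite EFinM -sumEFin; congr (_ * _)%E; apply: eq_bigr => i _.
rewrite integral_dirac//; last exact/measurable_EFinP.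
by rewrite diracT mul1e.
Qed.

Lemma integral_comp_marginal i (g : X -> R) : measurable_fun setT g ->
  (forall x, 0 <= g x) ->
  (\int[P]_w (g (U i w))%:E = \int[xi]_x (g x)%:E)%E.
Proof.
move=> mg g0.
transitivity (\int[distribution P (U i)]_x (g x)%:E)%E.
  rewrite /distribution ge0_integral_pushforward//; first exact/measurable_EFinP.
  by move=> x _; rewrite lee_fin.
by apply: eq_measure_integral => A mA _; exact: U_xi.
Qed.

Lemma integral_empirical_mean n (g : X -> R) : (0 < n)%N -> measurable_fun setT g ->
  (forall x, 0 <= g x) ->
  (\int[P]_w (n%:R^-1 * \sum_(i < n) g (U i w))%:E = \int[xi]_x (g x)%:E)%E.
Proof.
move=> n0 mg g0.
have mgU i : measurable_fun setT (g \o U i) by exact: measurableT_comp.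
under eq_integral do rewrite EFinM -sumEFin.
rewrite ge0_integralZl_EFin//; last 2 first.
- by move=> w _; apply: sume_ge0 => i _; rewrite lee_fin.
- by apply: emeasurable_sum => i; exact/measurable_EFinP/mgU.
rewrite ge0_integral_sum//; last 2 first.
- by move=> i; exact/measurable_EFinP/mgU.
- by move=> i w _; rewrite lee_fin.
under eq_bigr do rewrite integral_comp_marginal//.
have -> : (\sum_(i < n) \int[xi]_x (g x)%:E = n%:R%:E * \int[xi]_x (g x)%:E)%E.
  elim: n {n0} => [|m IH]; first by rewrite big_ord0 mul0e.
  by rewrite big_ord_recr/= IH -natr1 EFinD ge0_muleDl// mul1e.
rewrite muleA -EFinM mulVf ?mul1e// pnatr_eq0 -lt0n//.
Qed.

Lemma alpha_coef_event_le (f : nat -> R) :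
  (forall n, (0 < n)%N -> (alpha_coef U n <= (f n)%:E)%E) ->
  forall S i k, measurable S -> (0 < k)%N ->
  (`|P (U i @^-1` S `&` U (i + k)%N @^-1` S) -
     P (U i @^-1` S) * P (U (i + k)%N @^-1` S)| <= (f k)%:E)%E.
Proof.
move=> H S i k mS k0; apply: le_trans (H k k0); apply: ereal_sup_ubound.
have ev (I : set nat) m : I m -> sigma_process U I (U m @^-1` S).
  by move=> Im; apply: sub_sigma_algebra; exists m => //; exists S => //; rewrite setTI.
(* With indices from 0, the past of length [i.+1] ends at [U i], and the future at lag [k] starts
   exactly at [U (i + k)]. *)
exists i.+1, (U i @^-1` S), (U (i + k)%N @^-1` S); split => //.
- by apply: ev => /=.
- by apply: ev => /=; rewrite -addSn.
Qed.

End empirical.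

Section expected_wasserstein.
Context {dT : measure_display} {T : measurableType dT} {R : realType} {d : nat}
  {P : probability T R}.
Variables (U : nat -> {RV P >-> Rd R d}) (xi : probability (Rd R d) R).
Hypothesis U_xi : forall i (A : set (Rd R d)), measurable A ->
  distribution P (U i) A = xi A.
Variables (f : nat -> R) (F : R).
Hypothesis alpha_f : forall n, (0 < n)%N -> (alpha_coef U n <= (f n)%:E)%E.
Hypothesis sum_f : forall n, \sum_(1 <= k < n) f k <= F.

(** Take expectations in the pathwise dyadic bound. Each of the 2^((l+1)d) cells of level [l.+1]
    contributes one frequency deviation. The outer cost counts twice: once for [xi], and once for
    the empirical measure, whose expected integrals are those of [xi]. *)
Lemma expected_wasserstein_le_dyadic p K L n : 1 <= p -> 0 < K -> (0 < n)%N ->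
  (\int[P]_w wasserstein_pow p (empirical_measure U n w) xi <=
   (@dyadic_cost R d p K L + \sum_(l < L) @dyadic_cost R d p K l *
      ((2 ^ (l.+1 * d))%:R * Num.sqrt ((1 + 2 * F) / n%:R)))%:E
   + 2%:E * \int[xi]_x (outer_cost p K x)%:E)%E.
Proof.
move=> p1 K0 n0.
pose S l (j : {ffun 'I_d -> 'I_(2 ^ l)}) := @dyadic_set R d K L l j.
have mS l j : measurable (@S l j) by exact: measurable_dyadic_set.
pose G := @outer_cost R d p K.
have mG : measurable_fun setT G by exact: measurable_outer_cost.
have G0 x : 0 <= G x by exact: outer_cost_ge0.
have mGU i : measurable_fun setT (G \o U i) by exact: measurableT_comp.
have mUS l j i : measurable (U i @^-1` @S l j).
  by rewrite -[X in measurable X]setTI; exact: (measurable_funP (U i)).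
pose X l j (w : T) := `|n%:R^-1 * \sum_(i < n) \1_(U i @^-1` @S l j) w - fine (xi (@S l j))|.
have mX l j : measurable_fun setT (@X l j).
  apply: measurableT_comp => //; apply: measurable_funB => //; apply: measurable_funM => //.
  by apply: measurable_sum => i; exact: measurable_indic.
have X0 l j w : 0 <= @X l j w by exact: normr_ge0.
pose D := @dyadic_cost R d p K.
have D0 l : 0 <= D l by exact: dyadic_cost_ge0.
pose Y w := \sum_(l < L) D l * \sum_j @X l.+1 j w.
have mY : measurable_fun setT Y.
  apply: measurable_sum => l; apply: measurable_funM => //.
  by apply: measurable_sum => j; exact: mX.
have Y0 w : 0 <= Y w.
  by apply: sumr_ge0 => l _; rewrite mulr_ge0// sumr_ge0.
have mGm : measurable_fun setT (fun w => n%:R^-1 * \sum_(i < n) G (U i w)).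
  by apply: measurable_funM => //; apply: measurable_sum => i; exact: mGU.
have Gm0 w : 0 <= n%:R^-1 * \sum_(i < n) G (U i w).
  by rewrite mulr_ge0 ?invr_ge0// sumr_ge0.
apply: (@le_trans _ _ (\int[P]_w ((Y w)%:E + (D L)%:E + (n%:R^-1 * \sum_(i < n) G (U i w))%:E
    + \int[xi]_x (G x)%:E))%E).
  apply: ge0_le_integral_nonmeasurable => w; first exact: wasserstein_pow_ge0.
  have := @wasserstein_pow_le_dyadic R d p K L p1 K0 (empirical_measure U n w) xi
    (empirical_measureT U w n0).
  move=> /le_trans; apply; rewrite (integral_empirical_measure U n w mG G0).
  rewrite leeD2r// leeD2r// -EFinD lee_fin addrC lerD2r le_eqVlt; apply/orP; left; apply/eqP.
  apply: eq_bigr => l _; congr (_ * _); apply: eq_bigr => j _.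
  by rewrite empirical_measureE.
have IG0 : (0 <= \int[xi]_x (G x)%:E)%E by apply: integral_ge0 => x _; rewrite lee_fin.
have mYE : measurable_fun setT (EFin \o Y) by exact/measurable_EFinP.
have mGE : measurable_fun setT (fun w => (n%:R^-1 * \sum_(i < n) G (U i w))%:E).
  exact/measurable_EFinP.
have nonneg (h : T -> R) : (forall w, 0 <= h w) -> forall w, setT w -> (0 <= (h w)%:E)%E.
  by move=> h0 w _; rewrite lee_fin.
have mYD : measurable_fun setT (fun w => (Y w)%:E + (D L)%:E)%E by exact: emeasurable_funD.
have mYDG : measurable_fun setT
    (fun w => (Y w)%:E + (D L)%:E + (n%:R^-1 * \sum_(i < n) G (U i w))%:E)%E.
  exact: emeasurable_funD.
rewrite ge0_integralD; [|exact: measurableT| |exact: mYDG|by []|exact: measurable_cst]; last first.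
  by move=> w _; rewrite -!EFinD lee_fin !addr_ge0.
rewrite ge0_integralD; [|exact: measurableT| |exact: mYD|exact: nonneg|exact: mGE]; last first.
  by move=> w _; rewrite -EFinD lee_fin addr_ge0.
rewrite ge0_integralD; [|exact: measurableT|exact: nonneg|exact: mYE|exact: nonneg|
  exact: measurable_cst].
rewrite (integral_empirical_mean U_xi n0 mG G0) !integral_cst//=.
rewrite [P setT]probability_setT !mule1 -addeA.
apply: leeD; last first.
  by rewrite (mule_natl _ 2) mule2n.
rewrite addeC EFinD leeD2l//.
under eq_integral do rewrite /Y -sumEFin.
rewrite ge0_integral_sum//; last 2 first.
- move=> l; apply/measurable_EFinP; apply: measurable_funM => //.
  by apply: measurable_sum => j; exact: mX.
- by move=> l w _; rewrite lee_fin mulr_ge0// sumr_ge0.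
rewrite -sumEFin; apply: lee_sum => l _.
under eq_integral do rewrite EFinM -sumEFin.
rewrite ge0_integralZl_EFin//; last 2 first.
- by move=> w _; apply: sume_ge0 => j _; rewrite lee_fin.
- by apply: emeasurable_sum => j; exact/measurable_EFinP/mX.
rewrite EFinM lee_wpmul2l ?lee_fin//.
rewrite ge0_integral_sum//; last 2 first.
- by move=> j; exact/measurable_EFinP/mX.
- by move=> j w _; rewrite lee_fin.
have dev j : (\int[P]_w (@X l.+1 j w)%:E <= (Num.sqrt ((1 + 2 * F) / n%:R))%:E)%E.
  apply: (@frequency_deviation _ _ _ P (fun i => U i @^-1` @S l.+1 j) _ f) => //.
  - by move=> i; rewrite fineK ?fin_num_measure//; exact: U_xi.
  - by move=> i k k0; apply: alpha_coef_event_le.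
apply: (@le_trans _ _ (\sum_(j : {ffun 'I_d -> 'I_(2 ^ l.+1)})
    (Num.sqrt ((1 + 2 * F) / n%:R))%:E)%E); first by apply: lee_sum => j _; exact: dev.
by rewrite sumEFin lee_fin sumr_const card_dyadic -[leLHS]mulr_natl.
Qed.

End expected_wasserstein.

(** * Tail integral, comparison with the stated rate, and conclusion *)

Lemma integral_outer_cost_le (R : realType) (d : nat) (p q K : R)
    (xi : probability (Rd R d) R) (tail := 1 - fine (xi (open_ball0 K))) :
  1 <= p -> p < q -> (moment q xi < +oo)%E ->
  (\int[xi]_x (outer_cost p K x)%:E <=
   (2 `^ (p - 1) * (tail `^ ((q - p) / q) * fine (moment q xi) `^ (p / q) + tail * K `^ p))%:E)%E.
Proof.
move=> p1 pq mfin.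
pose A : set (Rd R d) := ~` open_ball0 K.
have mA : measurable A by apply: measurableC; exact: measurable_open_ball0.
have xiA : xi A = tail%:E.
  rewrite probability_setC; last exact: measurable_open_ball0.
  rewrite /tail EFinB fineK//.
  by apply: fin_num_measure; exact: measurable_open_ball0.
have mi : measurable_fun setT (\1_A : Rd R d -> R) by exact: measurable_indic.
have mn : measurable_fun setT (fun x : Rd R d => enorm x `^ p).
  exact: (measurableT_comp (measurable_powR _) measurable_enorm).
have p0 : 0 < p by exact: lt_le_trans p1.
(* Hoelder on the complement of the ball bounds the summand with the norm; the summand K^p is
   constant there and integrates to [tail * K ^ p]. *)
have H := hoelder_truncated_moment p0 pq (@measurable_enorm R d) (@enorm_ge0 R d) mA mfin.
rewrite /outer_cost -/A.
under eq_integral do rewrite EFinM.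
rewrite ge0_integralZl_EFin ?powR_ge0//; last 2 first.
- by move=> x _; rewrite lee_fin mulr_ge0 ?addr_ge0 ?powR_ge0.
- by apply/measurable_EFinP; apply: measurable_funM => //; apply: measurable_funD.
rewrite EFinM lee_wpmul2l ?lee_fin ?powR_ge0//.
under eq_integral do rewrite mulrDr EFinD.
rewrite ge0_integralD; [|exact: measurableT| | | |]; last 4 first.
- by move=> x _; rewrite lee_fin mulr_ge0 ?powR_ge0.
- by apply/measurable_EFinP; exact: measurable_funM.
- by move=> x _; rewrite lee_fin mulr_ge0 ?powR_ge0.
- by apply/measurable_EFinP; exact: measurable_funM.
rewrite EFinD leeD//; first by move: H; rewrite xiA.
under eq_integral do rewrite mulrC EFinM.
rewrite ge0_integralZl_EFin ?powR_ge0//; last first.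
  exact/measurable_EFinP.
by rewrite integral_indic// setIT [X in (_ * X)%E]xiA -EFinM mulrC.
Qed.

(** Compared factor by factor, with x^(2d) in the role of [n]: K^p <= K^(d/2), x^(-p) <= x^(2-p),
    and 4^p <= 2^(3d/2-p) since 3p < 3d/2. The bracket is at least 1 by its summand 1/(1 -
    2^(-p)). *)
Lemma multiscale_rate_le (R : realType) (d : nat) (p K x M Q B : R) :
  1 <= p -> p < d%:R / 2 -> 1 <= K -> 1 <= x -> 0 < M -> 0 <= B -> (2 * d%:R) * Q = (p - 2) ->
  (2 * K * Num.sqrt d%:R) `^ p * (2 `^ p * x `^ (- p) * (1 + 2 * B)) <=
  K `^ (d%:R / 2) * ((1 + 2 * B) * (x `^ (2 * d%:R)) `^ (- Q)
      * 2 `^ (3 * d%:R / 2 - p) * d%:R `^ (p / 2)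
      * ((1 + M `^ ((d%:R / 2 - p) / d%:R)) / (1 - 2 `^ (p - d%:R / 2))
         + (1 - 2 `^ (- p))^-1 + 4 * M `^ (d%:R^-1))).
Proof.
move=> p1 pd K1 x1 M0 B0 QE.
have two_lt1 e : e < 0 -> 2 `^ e < 1 :> R.
  move=> e0; have := @gt0_ltr_powR R (- e); rewrite oppr_gt0 => /(_ e0 1 2).
  rewrite !nnegrE powR1 powRN => /(_ ler01 (ler0n _ _) (ltr1n R 2)).
  by rewrite invf_gt1 ?powR_gt0.
set br := (_ / _ + _ + _).
have br1 : 1 <= br.
  have h1 : 0 <= (1 + M `^ ((d%:R / 2 - p) / d%:R)) / (1 - 2 `^ (p - d%:R / 2)).
    apply: divr_ge0; first by rewrite addr_ge0 ?powR_ge0.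
    by rewrite subr_ge0 ltW// two_lt1//; lra.
  have h2 : 1 <= (1 - 2 `^ (- p))^-1.
    rewrite invf_ge1; first by rewrite lerBlDr lerDl powR_ge0.
    by rewrite subr_gt0 two_lt1//; lra.
  have h3 : 0 <= 4 * M `^ (d%:R^-1) by rewrite mulr_ge0 ?powR_ge0.
  by rewrite /br; lra.
have d0 : 0 <= d%:R :> R by exact: ler0n.
have e1 : (2 * K * Num.sqrt d%:R) `^ p = 2 `^ p * K `^ p * d%:R `^ (p / 2).
  rewrite !powRM ?sqrtr_ge0//; [|lra..].
  by rewrite -powR12_sqrt// -powRrM [_ * p]mulrC.
have e2 : (x `^ (2 * d%:R)) `^ (- Q) = x `^ (2 - p).
  by rewrite -powRrM; congr (_ `^ _); rewrite mulrN QE opprB.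
have l1 : K `^ p <= K `^ (d%:R / 2) by rewrite ler_powR//; lra.
have l2 : x `^ (- p) <= x `^ (2 - p) by rewrite ler_powR//; lra.
have l3 : 2 `^ p * 2 `^ p <= 2 `^ (3 * d%:R / 2 - p) :> R.
  by rewrite -powRD ?pnatr_eq0 ?implybT// ler_powR ?ler1n//; lra.
rewrite e1 e2.
have C0 : 0 <= 1 + 2 * B by lra.
have D0 := powR_ge0 (d%:R : R) (p / 2).
rewrite [leLHS](_ : _ = K `^ p *
  ((1 + 2 * B) * x `^ (- p) * (2 `^ p * 2 `^ p) * d%:R `^ (p / 2) * 1)); last by ring.
rewrite ler_pM ?powR_ge0//.
  by rewrite mulr1 !mulr_ge0 ?powR_ge0.
rewrite ler_pM ?mulr_ge0 ?powR_ge0// ler_wpM2r// ler_pM ?mulr_ge0 ?powR_ge0//.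
by rewrite ler_wpM2l.
Qed.

Theorem theorem2 (R : realType) (f : nat -> R) (r0 : R)
    (f_ge0 : forall n : nat, (0 < n)%N -> 0 <= f n)
    (r0_gt1 : 1 < r0)
    (f_bigO : f =O_\oo (fun n : nat => n%:R `^ (- r0) : R)) :
  exists c0 : R,
  forall (d : nat) (p q : R), 1 <= p -> p < d%:R / 2 -> p < q ->
  forall xi : probability (Rd R d) R,
    (moment q xi < +oo)%E ->
  forall M : R, 0 < M ->
    (exists h : Rd R d -> R, is_lebesgue_density xi h /\
       {ae lebesgue_tuple R d, forall x, h x <= M}) ->
  forall (dT : measure_display) (T : measurableType dT) (P : probability T R)
    (U : nat -> {RV P >-> Rd R d}),
    strictly_stationary U ->
    alpha_mixing U ->
    (forall (i : nat) (A : set (Rd R d)), measurable A ->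
       distribution P (U i) A = xi A) ->
    (forall n : nat, (0 < n)%N -> (alpha_coef U n <= (f n)%:E)%E) ->
  forall n K : nat, (0 < n)%N -> (0 < K)%N ->
    let tail : R := 1 - fine (xi (open_ball0 K%:R)) in
    let mq : R := fine (moment q xi) in
    let Mfrak_p : R :=
      c0 * n%:R `^ (- ((p - 2) / (2 * d%:R)))
      * 2 `^ (3 * d%:R / 2 - p) * d%:R `^ (p / 2)
      * ((1 + M `^ ((d%:R / 2 - p) / d%:R)) / (1 - 2 `^ (p - d%:R / 2))
         + (1 - 2 `^ (- p))^-1 + 4 * M `^ (d%:R^-1)) in
    (\int[P]_w wasserstein_pow p (empirical_measure U n w) xi <=
     (3 `^ (p - 1)
      * (2 `^ p * (tail `^ ((q - p) / q) * mq `^ (p / q) + tail * K%:R `^ p)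
         + K%:R `^ (d%:R / 2) * Mfrak_p))%:E)%E.
Proof.
have [F F0 sum_f] := bigO_powRN_sum_bounded r0_gt1 f_bigO.
(* [F] and [B] are fixed before the dimension, the exponents and the process are introduced, so
   [c0 = 1 + 2 * B] depends on [f] and [r0] alone. *)
pose B := Num.sqrt (1 + 2 * F).
have B0 : 0 <= B by exact: sqrtr_ge0.
exists (1 + 2 * B) => d p q p1 pd pq xi mfin M M0 _ dT T P U _ _ U_xi alpha_f n K n0 K0.
cbv zeta.
set tail := 1 - fine (xi _); set br := (_ / _ + _ + _).
have d0 : (0 < d)%N by rewrite -(ltr_nat R); lra.
have dR0 : 0 < d%:R :> R by rewrite ltr0n.
have K1 : 1 <= K%:R :> R by rewrite ler1n.
have KR0 : 0 < K%:R :> R by rewrite ltr0n.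
pose x : R := n%:R `^ (2 * d%:R)^-1.
have x1 : 1 <= x.
  by rewrite -[leLHS](powRr0 (n%:R : R)) ler_powR ?ler1n// invr_ge0 mulr_ge0.
have xn : x `^ (2 * d%:R) = n%:R.
  by rewrite -powRrM mulVf ?powRr1// mulf_neq0// gt_eqF.
have [L /andP[Lx xL]] := @exists_dyadic_scale R n d n0 d0.
(* As [n] is x^(2d), its square root is x^d. *)
have dev : Num.sqrt ((1 + 2 * F) / n%:R) = B * x `^ (- d%:R).
  rewrite sqrtrM; last by lra.
  rewrite sqrtrV ?ler0n// -[Num.sqrt n%:R]powR12_sqrt ?ler0n// -xn -powRrM powRN.
  by congr (_ * (_ `^ _)^-1); field.
apply: le_trans (expected_wasserstein_le_dyadic U_xi alpha_f sum_f L p1 KR0 n0) _.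
rewrite dev.
have S1 := @dyadic_scale_sum_le R p x B d L K%:R p1 pd KR0 B0 Lx xL.
have QE : 2 * d%:R * ((p - 2) / (2 * d%:R)) = p - 2 :> R by field; rewrite gt_eqF.
have S2 := @multiscale_rate_le R d p K%:R x M _ B p1 pd K1 x1 M0 B0 QE.
rewrite xn -/br in S2.
have I := @integral_outer_cost_le R d p q K%:R xi p1 pq mfin.
rewrite -/tail in I.
set S := _ + _ in S1 *.
set W := _ + tail * _ in I *.
set Z := K%:R `^ (d%:R / 2) * _ in S2 *.
apply: (@le_trans _ _ (S%:E + 2%:E * (2 `^ (p - 1) * W)%:E)%E).
  by rewrite leeD2l// lee_wpmul2l// lee_fin.
rewrite -EFinM -EFinD lee_fin mulrA.
(* The two outer costs, each carrying 2^(p-1) from convexity, give the factor 2^p of the tail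
   term. *)
have -> : 2 * 2 `^ (p - 1) = 2 `^ p :> R by rewrite mulr_powRB1//; lra.
have t0 : 0 <= tail.
  rewrite subr_ge0 -lee_fin fineK ?fin_num_measure ?probability_le1//;
    exact: measurable_open_ball0.
have W0 : 0 <= 2 `^ p * W.
  by rewrite mulr_ge0 ?powR_ge0// addr_ge0// mulr_ge0 ?powR_ge0.
have SZ : S <= Z by exact: le_trans S2.
(* With [Z] and the tail term nonnegative, multiplication by 3^(p-1) >= 1 can only enlarge the
   bound. *)
have Z0 : 0 <= Z.
  apply: le_trans SZ; rewrite addr_ge0 ?dyadic_cost_ge0// sumr_ge0// => l _.
  by rewrite !mulr_ge0 ?powR_ge0.
have T1 : 1 <= 3 `^ (p - 1) :> R.
  by rewrite -[leLHS](powRr0 (3 : R)) ler_powR ?ler1n//; lra.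
rewrite addrC; apply: (@le_trans _ _ (2 `^ p * W + Z)); first by rewrite lerD2l.
by rewrite ler_peMl// addr_ge0.
Qed.
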